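(* Let $\Bbbk$ be an algebraically closed field of characteristic zero, $n$ a positive integer, and $\omega_1,\omega_2\in\Bbbk$ primitive $n$-th roots of unity. Let $S_i$ be the antipode of the Taft algebra $T_{n^2}(\omega_i)$, $i=1,2$. Then $\operatorname{Tr}(S_1)=\operatorname{Tr}(S_2)$ if and only if $\omega_1=\omega_2$. In particular, $T_{n^2}(\omega_1)$ and $T_{n^2}(\omega_2)$ are gauge equivalent if and only if $\omega_1=\omega_2$.
   Context: For a primitive $n$-th root of unity $\omega\in\Bbbk$, the Taft algebra $T_{n^2}(\omega)$ is the $\Bbbk$-algebra generated by $g$ and $x$ subject to $g^n=1$, $x^n=0$, $xg=\omega gx$. It is a Hopf algebra of dimension $n^2$ with basis $\{g^ix^k\mid 0\le i,k\le n-1\}$ and $\Delta(g)=g\otimes g$, $\Delta(x)=x\otimes1+g\otimes x$, $\varepsilon(g)=1$, $\varepsilon(x)=0$, $S(g)=g^{-1}$, $S(x)=-g^{-1}x$. A gauge transformation of a Hopf algebra $H$ is an invertible $F\in H\otimes H$ with $(\varepsilon\otimes\mathrm{id})(F)=(\mathrm{id}\otimes\varepsilon)(F)=1$. It is a 2-cocycle if $(1\otimes F)(\mathrm{id}\otimes\Delta)(F)=(F\otimes1)(\Delta\otimes\mathrm{id})(F)$. For a 2-cocycle $F$, the twist $H^F$ is the Hopf algebra with the same algebra structure and counit as $H$ and with comultiplication $\Delta_F(h)=F\Delta(h)F^{-1}$. Hopf algebras $H,H'$ over $\Bbbk$ are gauge equivalent if there is a 2-cocycle $F$ of $H$ such that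 $H'\cong H^F$ as bialgebras. *)

(* Defs.v *)
From HB Require Import structures.
From mathcomp Require Import all_boot all_order all_algebra.
From mathcomp Require Import falgebra.

Set Implicit Arguments.
Unset Strict Implicit.
Unset Printing Implicit Defensive.

Import GRing.Theory.
Local Open Scope ring_scope.

Section TensorSpace.
Variable k : fieldType.

Definition bilin (A B C : lmodType k) (f : A -> B -> C) : Prop :=
  (forall b, linear (f^~ b)) /\ (forall a, linear (f a)).

Lemma bilinSl (A B C : lmodType k) (f : A -> B -> C) I (r : seq I)
    (c : I -> k) (v : I -> A) b :
  bilin f -> f (\sum_(i <- r) c i *: v i) b = \sum_(i <- r) c i *: f (v i) b.
Proof.
case=> fl _; elim/big_rec2: _ => [|i y1 y2 _ <-]; last exact: fl.
by have := fl b (-1) 0 0; rewrite scaleN1r oppr0 addr0 scaleN1r addNr.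
Qed.

Lemma bilinSr (A B C : lmodType k) (f : A -> B -> C) I (r : seq I)
    (c : I -> k) (v : I -> B) a :
  bilin f -> f a (\sum_(i <- r) c i *: v i) = \sum_(i <- r) c i *: f a (v i).
Proof.
case=> _ fr; elim/big_rec2: _ => [|i y1 y2 _ <-]; last exact: fr.
by have := fr a (-1) 0 0; rewrite scaleN1r oppr0 addr0 scaleN1r addNr.
Qed.

Lemma linear_comb (A C : lmodType k) (f g : A -> C) d :
  linear f -> linear g -> linear (fun t => d *: f t + g t).
Proof.
move=> fl gl e x y; rewrite fl gl !scalerDr !scalerA addrACA.
by rewrite [d * e]mulrC.
Qed.

(* The tensor product of two finite-dimensional spaces, by coordinates in     *)
(* the product of two fixed bases; [tliftE] and [tlift_uniq] below are its     *)
(* universal property.                                                        *)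
Definition tensor (A B : vectType k) : Type := 'M[k]_(\dim {:A}, \dim {:B}).
HB.instance Definition _ (A B : vectType k) := Vector.on (tensor A B).

Definition tens (A B : vectType k) (a : A) (b : B) : tensor A B :=
  \matrix_(i, j) (coord (vbasis {:A}) i a * coord (vbasis {:B}) j b).

(* The linear map on the tensor product induced by a bilinear map. *)
Definition tlift (A B C : vectType k) (f : A -> B -> C) (t : tensor A B) : C :=
  \sum_i \sum_j t i j *: f (vbasis {:A})`_i (vbasis {:B})`_j.

Lemma tlift_is_linear (A B C : vectType k) (f : A -> B -> C) :
  linear (tlift f).
Proof.
move=> c t u; rewrite /tlift scaler_sumr -big_split; apply: eq_bigr => i _ /=.
rewrite scaler_sumr -big_split; apply: eq_bigr => j _ /=.
by rewrite !mxE scalerDl scalerA.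
Qed.
HB.instance Definition _ (A B C : vectType k) (f : A -> B -> C) :=
  GRing.isSemilinear.Build k (tensor A B) C _ (tlift f)
    (GRing.semilinear_linear (tlift_is_linear f)).

Lemma tens_bilin (A B : vectType k) : bilin (@tens A B).
Proof.
split=> [b|a] c u v; apply/matrixP=> i j; rewrite !mxE linearP /=.
  by rewrite mulrDl mulrA.
by rewrite mulrDr mulrCA.
Qed.

Lemma tliftE (A B C : vectType k) (f : A -> B -> C) a b :
  bilin f -> tlift f (tens a b) = f a b.
Proof.
move=> fb; rewrite [in RHS](coord_vbasis (memvf a)) bilinSl //.
apply: eq_bigr => i _; rewrite [in RHS](coord_vbasis (memvf b)) bilinSr //.
rewrite scaler_sumr; apply: eq_bigr => j _.
by rewrite mxE scalerA.
Qed.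

Lemma tens_span (A B : vectType k) (t : tensor A B) : t = tlift (@tens A B) t.
Proof.
apply/matrixP=> i j.
have cE (C : vectType k) (p q : 'I_(\dim {:C})) : coord (vbasis {:C}) p (vbasis {:C})`_q = (q == p)%:R.
  by rewrite coord_free ?(basis_free (vbasisP _)).
rewrite /tlift summxE (bigD1 i) //= summxE (bigD1 j) //= !mxE !cE !eqxx /= !mulr1.
rewrite big1 ?addr0 => [|j' /negPf nj]; last by rewrite !mxE !cE nj !mulr0.
rewrite big1 ?addr0 // => i' /negPf ni.
by rewrite summxE big1 // => j' _; rewrite !mxE !cE ni mul0r mulr0.
Qed.

Lemma tens_ext (A B : vectType k) (C : lmodType k) (f g : tensor A B -> C) :
  linear f -> linear g -> (forall a b, f (tens a b) = g (tens a b)) -> f =1 g.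
Proof.
move=> fl gl fg t.
pose F := GRing.isSemilinear.Build k (tensor A B) C _ f (GRing.semilinear_linear fl).
pose G := GRing.isSemilinear.Build k (tensor A B) C _ g (GRing.semilinear_linear gl).
pose f' : {linear tensor A B -> C} := HB.pack f F.
pose g' : {linear tensor A B -> C} := HB.pack g G.
rewrite -[f]/(f' : _ -> _) -[g]/(g' : _ -> _) (tens_span t) /tlift !linear_sum.
apply: eq_bigr => i _; rewrite !linear_sum; apply: eq_bigr => j _.
by rewrite !linearZ /= fg.
Qed.

Lemma tlift_uniq (A B C : vectType k) (f : A -> B -> C) (g : tensor A B -> C) :
  bilin f -> linear g -> (forall a b, g (tens a b) = f a b) -> g =1 tlift f.
Proof.
move=> fb gl gf; apply: tens_ext => // [|a b]; first exact: tlift_is_linear.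
by rewrite gf tliftE.
Qed.

Definition tmap (A B C D : vectType k) (f : 'Hom(A, C)) (g : 'Hom(B, D)) :
    'Hom(tensor A B, tensor C D) :=
  linfun (tlift (fun a b => tens (f a) (g b))).

Definition tassoc (A B C : vectType k) :
    'Hom(tensor (tensor A B) C, tensor A (tensor B C)) :=
  linfun (tlift (fun (t : tensor A B) c =>
    tlift (fun a b => tens a (tens b c)) t)).

End TensorSpace.

Notation "a *t b" := (tens a b) (at level 40, left associativity) : ring_scope.

Section TensorTheory.
Variable k : fieldType.

Lemma tmap_bilin (A B C D : vectType k) (f : 'Hom(A, C)) (g : 'Hom(B, D)) :
  bilin (fun a b => f a *t g b).
Proof.
have [tl tr] := tens_bilin C D.
by split=> [b|a] c u v /=; rewrite linearP ?(tl (g b)) ?(tr (f a)).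
Qed.

Lemma tmapE (A B C D : vectType k) (f : 'Hom(A, C)) (g : 'Hom(B, D)) a b :
  tmap f g (a *t b) = f a *t g b.
Proof. by rewrite lfunE /= tliftE //; apply: tmap_bilin. Qed.

Lemma tassoc_bilin1 (A B C : vectType k) c :
  bilin (fun (a : A) (b : B) => a *t (b *t c) : tensor A (tensor B C)).
Proof.
have [tl tr] := tens_bilin A (tensor B C); have [tl' _] := tens_bilin B C.
by split=> [b|a] d u v /=; [exact: tl|rewrite -tr -(tl' c)].
Qed.

Lemma tassoc_bilin2 (A B C : vectType k) :
  bilin (fun (t : tensor A B) (c : C) =>
    tlift (fun a b => a *t (b *t c)) t : tensor A (tensor B C)).
Proof.
split=> [c|t] d u v /=; first by rewrite linearP.
move: t; apply: (tens_ext (A := A) (B := B)) => [||a b].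
- exact: tlift_is_linear.
- by apply: linear_comb; exact: tlift_is_linear.
- rewrite !tliftE; try exact: tassoc_bilin1.
  have [_ tr] := tens_bilin A (tensor B C); have [_ tr'] := tens_bilin B C.
  by rewrite -tr -tr'.
Qed.

Lemma tassocE (A B C : vectType k) (a : A) (b : B) (c : C) :
  tassoc A B C (a *t b *t c) = a *t (b *t c).
Proof.
rewrite lfunE /= tliftE; last exact: tassoc_bilin2.
by rewrite tliftE //; apply: tassoc_bilin1.
Qed.

End TensorTheory.

Section TensorAlgebra.
Variables (k : fieldType) (A B : falgType k).
Implicit Types t u v : tensor A B.

(* (a (x) b)(a' (x) b') = aa' (x) bb', see [tensM] below. *)
Definition tensor_mul t u : tensor A B :=
  tlift (fun a b => tlift (fun a' b' => (a * a') *t (b * b')) u) t.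

Fact tensor_mul_bilin1 (a : A) (b : B) :
  bilin (fun a' b' => (a * a') *t (b * b')).
Proof.
have [tl tr] := tens_bilin A B.
by split=> [b'|a'] c x y /=; rewrite mulrDr -scalerAr ?tl ?tr.
Qed.

Fact tensor_mul_bilin2 u :
  bilin (fun (a : A) (b : B) => tlift (fun a' b' => (a * a') *t (b * b')) u).
Proof.
have [tl tr] := tens_bilin A B.
split=> [b|a] c x y /=; move: u; apply: tens_ext => [||a' b'];
  try exact: tlift_is_linear.
- by apply: linear_comb; exact: tlift_is_linear.
- by rewrite !tliftE ?mulrDl -?scalerAl ?tl //; apply: tensor_mul_bilin1.
- by apply: linear_comb; exact: tlift_is_linear.
- by rewrite !tliftE ?mulrDl -?scalerAl ?tr //; apply: tensor_mul_bilin1.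
Qed.

Fact tensor_mulE (a a' : A) (b b' : B) :
  tensor_mul (a *t b) (a' *t b') = (a * a') *t (b * b').
Proof.
rewrite /tensor_mul tliftE; last exact: tensor_mul_bilin2.
by rewrite tliftE //; apply: tensor_mul_bilin1.
Qed.

Fact tensor_mul_bilin : bilin tensor_mul.
Proof.
split=> [u|t] c x y /=; first exact: tlift_is_linear.
move: t; apply: tens_ext => [||a b]; first exact: tlift_is_linear.
  by apply: linear_comb; exact: tlift_is_linear.
by rewrite /tensor_mul !tliftE ?linearP //; apply: tensor_mul_bilin2.
Qed.

Let mull u : linear (tensor_mul^~ u). Proof. by case: tensor_mul_bilin. Qed.
Let mulr t : linear (tensor_mul t). Proof. by case: tensor_mul_bilin. Qed.

Fact tensor_mulA : associative tensor_mul.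
Proof.
move=> t u v; move: t; apply: tens_ext => [||a b]; first exact: mull.
  by move=> c x y; rewrite !mull.
move: u; apply: tens_ext => [||a' b'].
- by move=> c x y; rewrite mull mulr.
- by move=> c x y; rewrite mulr mull.
move: v; apply: tens_ext => [||a'' b''].
- by move=> c x y; rewrite !mulr.
- by move=> c x y; rewrite !mulr.
by rewrite !tensor_mulE !mulrA.
Qed.

Fact tensor_mul1 : left_id (1 *t 1) tensor_mul.
Proof.
by apply: tens_ext => [|//|a b]; [exact: mulr|rewrite tensor_mulE !mul1r].
Qed.

Fact tensor_1mul : right_id (1 *t 1) tensor_mul.
Proof.
by apply: tens_ext => [|//|a b]; [exact: mull|rewrite tensor_mulE !mulr1].
Qed.

Fact tensor_mulDl : left_distributive tensor_mul +%R.
Proof. by move=> t u v; have := mull v 1 t u; rewrite !scale1r. Qed.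

Fact tensor_mulDr : right_distributive tensor_mul +%R.
Proof. by move=> t u v; have := mulr t 1 u v; rewrite !scale1r. Qed.

Fact tensor_1neq0 : (1 : A) *t (1 : B) != 0 :> tensor A B.
Proof.
apply/eqP => /matrixP E.
have nz (C : falgType k) : exists i, coord (vbasis {:C}) i 1 != 0.
  apply/existsP; apply: contraTT (oner_neq0 C); rewrite negb_exists.
  move=> /forallP h; rewrite negbK (coord_vbasis (memvf (1 : C))).
  by rewrite big1 // => i _; rewrite (eqP (negPn (h i))) scale0r.
have [i hi] := nz A; have [j hj] := nz B.
by have /eqP := E i j; rewrite !mxE mulf_eq0 (negPf hi) (negPf hj).
Qed.

HB.instance Definition _ := GRing.Zmodule_isNzRing.Build (tensor A B)
  tensor_mulA tensor_mul1 tensor_1mul tensor_mulDl tensor_mulDr tensor_1neq0.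

Fact tensor_scaleAl c t u : c *: (t * u) = (c *: t) * u.
Proof.
have := mull u c t 0; rewrite !addr0 => E; rewrite [RHS]E.
by rewrite (_ : tensor_mul 0 u = 0) ?addr0 // -[LHS]/(0 * u) mul0r.
Qed.
HB.instance Definition _ :=
  GRing.Lmodule_isLalgebra.Build k (tensor A B) tensor_scaleAl.

Fact tensor_scaleAr c t u : c *: (t * u) = t * (c *: u).
Proof.
have := mulr t c u 0; rewrite !addr0 => E; rewrite [RHS]E.
by rewrite (_ : tensor_mul t 0 = 0) ?addr0 // -[LHS]/(t * 0) mulr0.
Qed.
HB.instance Definition _ :=
  GRing.Lalgebra_isAlgebra.Build k (tensor A B) tensor_scaleAr.
HB.instance Definition _ := Algebra_isFalgebra.Build k (tensor A B).

Lemma tensM (a a' : A) (b b' : B) :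
  (a *t b) * (a' *t b') = (a * a') *t (b * b') :> tensor A B.
Proof. exact: tensor_mulE. Qed.

Lemma tens1 : (1 : A) *t (1 : B) = 1 :> tensor A B.
Proof. by []. Qed.

End TensorAlgebra.

Section AlgebraMaps.
Variable k : fieldType.

Section MkAhom.
Variables (A B : falgType k) (f : A -> B).
Hypotheses (fl : linear f) (f1 : f 1 = 1) (fM : {morph f : x y / x * y}).

Let f_lin : {linear A -> B} :=
  HB.pack f (GRing.isSemilinear.Build k A B _ f (GRing.semilinear_linear fl)).

Fact mk_ahom_subproof : ahom_in {:A} (linfun f_lin).
Proof. by apply/ahom_inP; split=> [x y _ _|]; rewrite !lfunE /= ?fM. Qed.

Definition mk_ahom : 'AHom(A, B) := AHom mk_ahom_subproof.

Lemma mk_ahomE x : mk_ahom x = f x. Proof. by rewrite lfunE. Qed.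
End MkAhom.

Lemma tens_mult (A B C : falgType k) (f : 'Hom(tensor A B, C)) :
    (forall a b a' b', f ((a * a') *t (b * b')) = f (a *t b) * f (a' *t b')) ->
  {morph f : x y / x * y}.
Proof.
move=> fM t u; move: t; apply: tens_ext => [||a b].
- by move=> c x y; rewrite -linearP mulrDl -scalerAl.
- by move=> c x y; rewrite linearP mulrDl -scalerAl.
move: u; apply: tens_ext => [||a' b'].
- by move=> c x y; rewrite -linearP mulrDr -scalerAr.
- by move=> c x y; rewrite linearP mulrDr -scalerAr.
by rewrite tensM fM.
Qed.

Fact tmap_is_ahom (A B C D : falgType k) (f : 'AHom(A, C)) (g : 'AHom(B, D)) :
  ahom_in {:tensor A B} (tmap f g).
Proof.
apply/ahom_inP; split=> [x y _ _|]; last first.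
  by rewrite -tens1 tmapE !rmorph1 tens1.
by apply: tens_mult => a b a' b'; rewrite !tmapE !rmorphM tensM.
Qed.
Canonical tmap_ahom A B C D f g := AHom (@tmap_is_ahom A B C D f g).

Fact tassoc_is_ahom (A B C : falgType k) :
  ahom_in {:tensor (tensor A B) C} (tassoc A B C).
Proof.
apply/ahom_inP; split=> [x y _ _|]; last first.
  by rewrite -!tens1 tassocE.
apply: tens_mult => t c t' c'.
have [tl tr] := tens_bilin (tensor A B) C.
move: t; apply: tens_ext => [||a b].
- by move=> d u v; rewrite -linearP -tl mulrDl -scalerAl.
- by move=> d u v; rewrite tl linearP mulrDl -scalerAl.
move: t'; apply: tens_ext => [||a' b'].
- by move=> d u v; rewrite -linearP -tl mulrDr -scalerAr.
- by move=> d u v; rewrite tl linearP mulrDr -scalerAr.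
by rewrite tensM !tassocE !tensM.
Qed.
Canonical tassoc_ahom A B C := AHom (@tassoc_is_ahom A B C).

(* e (x) id and id (x) e, after identifying k (x) A and A (x) k with A. *)
Definition tcounitl (A : falgType k) (e : 'AHom(A, k^o)) : 'Hom(tensor A A, A) :=
  linfun (tlift (fun a b : A => (e a : k) *: b)).
Definition tcounitr (A : falgType k) (e : 'AHom(A, k^o)) : 'Hom(tensor A A, A) :=
  linfun (tlift (fun a b : A => (e b : k) *: a)).

Lemma tcounitlE (A : falgType k) (e : 'AHom(A, k^o)) (a b : A) :
  tcounitl e (a *t b) = (e a : k) *: b.
Proof.
rewrite lfunE /= tliftE //; split=> [c|c] d u v /=.
  by rewrite linearP /= scalerDl scalerA.
by rewrite scalerDr !scalerA mulrC.
Qed.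

Lemma tcounitrE (A : falgType k) (e : 'AHom(A, k^o)) (a b : A) :
  tcounitr e (a *t b) = (e b : k) *: a.
Proof.
rewrite lfunE /= tliftE //; split=> [c|c] d u v /=.
  by rewrite scalerDr !scalerA mulrC.
by rewrite linearP /= scalerDl scalerA.
Qed.

Fact tcounitl_is_ahom (A : falgType k) (e : 'AHom(A, k^o)) :
  ahom_in {:tensor A A} (tcounitl e).
Proof.
apply/ahom_inP; split=> [x y _ _|]; last first.
  by rewrite -tens1 tcounitlE rmorph1 scale1r.
apply: tens_mult => a b a' b'; rewrite !tcounitlE rmorphM.
by rewrite -scalerAl -scalerAr scalerA.
Qed.
Canonical tcounitl_ahom A e := AHom (@tcounitl_is_ahom A e).

Fact tcounitr_is_ahom (A : falgType k) (e : 'AHom(A, k^o)) :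
  ahom_in {:tensor A A} (tcounitr e).
Proof.
apply/ahom_inP; split=> [x y _ _|]; last first.
  by rewrite -tens1 tcounitrE rmorph1 scale1r.
apply: tens_mult => a b a' b'; rewrite !tcounitrE rmorphM.
by rewrite -scalerAl -scalerAr scalerA.
Qed.
Canonical tcounitr_ahom A e := AHom (@tcounitr_is_ahom A e).
End AlgebraMaps.

Record bialgebra (k : fieldType) := Bialgebra {
  bialg_alg :> falgType k;
  comul : 'AHom(bialg_alg, tensor bialg_alg bialg_alg);
  counit : 'AHom(bialg_alg, k^o);
  comulA : forall h, tassoc _ _ _ (tmap comul \1 (comul h)) =
                     tmap \1 comul (comul h);
  counitl : forall h, tcounitl counit (comul h) = h;
  counitr : forall h, tcounitr counit (comul h) = h
}.
Arguments comul {k}.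
Arguments counit {k}.

Definition bialg_iso (k : fieldType) (H H' : bialgebra k) : Prop :=
  exists f : 'AHom(H, H'),
    [/\ bijective f,
        forall h, comul H' (f h) = tmap f f (comul H h)
      & forall h, counit H' (f h) = counit H h].

Record hopf_algebra (k : fieldType) := HopfAlgebra {
  hopf_bialg :> bialgebra k;
  antipode : 'End(hopf_bialg);
  antipodel : forall h,
    tlift (fun a b => antipode a * b) (comul hopf_bialg h) =
    (counit hopf_bialg h : k)%:A;
  antipoder : forall h,
    tlift (fun a b => a * antipode b) (comul hopf_bialg h) =
    (counit hopf_bialg h : k)%:A
}.
Arguments antipode {k}.

Definition gauge_transformation (k : fieldType) (H : hopf_algebra k)
    (F : tensor H H) : Prop :=
  [/\ F \is a GRing.unit, tcounitl (counit H) F = 1 & tcounitr (counit H) F = 1].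

Definition two_cocycle (k : fieldType) (H : hopf_algebra k)
    (F : tensor H H) : Prop :=
  gauge_transformation F /\
  (1 *t F) * tmap \1 (comul H) F =
    tassoc H H H ((F *t 1) * tmap (comul H) \1 F).

(* H' ~ H^F is an isomorphism of bialgebras in the definition of gauge         *)
(* equivalence, so the antipode of the twist is not recorded.                 *)
Section Twist.
Variables (k : fieldType) (H : hopf_algebra k) (F : tensor H H).
Hypothesis Fcocycle : two_cocycle F.

Let Funit : F \is a GRing.unit. Proof. by case: Fcocycle => -[]. Qed.

Fact twist_linear : linear (fun h => F * comul H h / F).
Proof. by move=> c x y; rewrite linearP mulrDr mulrDl -scalerAr -scalerAl. Qed.

Fact twist_one : F * comul H 1 / F = 1.
Proof. by rewrite rmorph1 mulr1 divrr. Qed.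

Fact twist_mul : {morph (fun h => F * comul H h / F) : x y / x * y}.
Proof. move=> x y; rewrite rmorphM [RHS]mulrA -[F * comul H x / F * _]mulrA.
by rewrite mulKr // mulrA. Qed.

Definition twist_comul : 'AHom(H, tensor H H) :=
  mk_ahom twist_linear twist_one twist_mul.

Lemma twist_comulE h : twist_comul h = F * comul H h / F.
Proof. exact: mk_ahomE. Qed.

Fact twist_comulA h :
  tassoc H H H (tmap twist_comul \1 (twist_comul h)) =
  tmap \1 twist_comul (twist_comul h).
Proof.
have [_ cF] := Fcocycle.
pose I : 'AHom(H, H) := id_ahom H.
pose D := tmap_ahom (comul H) I; pose D' := tmap_ahom I (comul H).
pose al := tassoc_ahom H H H.
pose Fl : tensor (tensor H H) H := F *t 1.
pose Fr : tensor H (tensor H H) := 1 *t F.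
pose Gl : tensor (tensor H H) H := F^-1 *t 1.
pose Gr : tensor H (tensor H H) := 1 *t F^-1.
have GFl : Gl * Fl = 1 by rewrite tensM mulVr // mulr1.
have GFr : Gr * Fr = 1 by rewrite tensM mulVr // mulr1.
have FGr : Fr * Gr = 1 by rewrite tensM divrr // mulr1.
have El t : tmap twist_comul \1 t = Fl * D t * Gl.
  move: t; apply: tens_ext => [||a b]; first exact: linearP.
    by move=> c x y; rewrite linearP mulrDr mulrDl -scalerAr -scalerAl.
  by rewrite !tmapE !id_lfunE !tensM twist_comulE mulr1 mul1r.
have Er t : tmap \1 twist_comul t = Fr * D' t * Gr.
  move: t; apply: tens_ext => [||a b]; first exact: linearP.
    by move=> c x y; rewrite linearP mulrDr mulrDl -scalerAr -scalerAl.
  by rewrite !tmapE !id_lfunE !tensM twist_comulE mulr1 mul1r.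
rewrite El Er twist_comulE.
have [P EP EP'] : exists2 P, P = Fr * D' F & P = al (Fl * D F).
  by exists (Fr * D' F).
have PI : P * (D' F^-1 * Gr) = 1.
  by rewrite EP mulrA -[Fr * _ * _]mulrA -rmorphM divrr // rmorph1 mulr1.
have IP : (D' F^-1 * Gr) * P = 1.
  by rewrite EP -mulrA [Gr * _]mulrA GFr mul1r -rmorphM mulVr // rmorph1.
have inj : injective ( *%R^~ P).
  by move=> x y /= /(congr1 (fun z => z * (D' F^-1 * Gr))); rewrite -!mulrA PI !mulr1.
apply: inj => /=.
transitivity (P * al (D (comul H h))).
  rewrite EP' -[tassoc _ _ _ _]/(al _) -!rmorphM; congr (al _).
  rewrite !rmorphM -!mulrA [Gl * _]mulrA GFl mul1r -rmorphM mulVr //.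
  by rewrite rmorph1 mulr1.
rewrite -[al (D _)]/(tassoc H H H (tmap _ _ _)) comulA -[tmap _ _ _]/(D' _).
rewrite EP !rmorphM -!mulrA [Gr * _]mulrA GFr mul1r -[D' F^-1 * _]rmorphM mulVr //.
by rewrite rmorph1 mulr1.
Qed.

Fact twist_counitl h : tcounitl (counit H) (twist_comul h) = h.
Proof.
have [[_ e1 _] _] := Fcocycle; rewrite twist_comulE.
by rewrite !rmorphM rmorphV //= counitl e1 invr1 mulr1 mul1r.
Qed.

Fact twist_counitr h : tcounitr (counit H) (twist_comul h) = h.
Proof.
have [[_ _ e1] _] := Fcocycle; rewrite twist_comulE.
by rewrite !rmorphM rmorphV //= counitr e1 invr1 mulr1 mul1r.
Qed.

Definition twist : bialgebra k :=
  @Bialgebra k H twist_comul (counit H) twist_comulA twist_counitl twist_counitr.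

End Twist.

Definition gauge_equivalent (k : fieldType) (H H' : hopf_algebra k) : Prop :=
  exists (F : tensor H H) (hF : two_cocycle F), bialg_iso H' (twist hF).

Definition lfun_trace (k : fieldType) (V : vectType k) (f : 'End(V)) : k :=
  \tr (passmx.mxof (vbasis {:V}) (vbasis {:V}) f).

Section QBinomial.
Variables (k : fieldType) (n : nat) (w : k).
Hypothesis hw : n.-primitive_root w.

Fixpoint qbin (m j : nat) : k :=
  match m, j with
  | _, 0 => 1
  | 0, _.+1 => 0
  | m'.+1, j'.+1 => w ^+ j'.+1 * qbin m' j'.+1 + qbin m' j'
  end.

Lemma qbin0 m : qbin m 0 = 1. Proof. by case: m. Qed.

Lemma qbin_small m j : (m < j)%N -> qbin m j = 0.
Proof.
elim: m j => [|m IH] [|j] //= hj.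
by rewrite !IH ?mulr0 ?addr0 // ltnW.
Qed.

Lemma qbin_ratio m j : (j <= m)%N ->
  (1 - w ^+ j.+1) * qbin m j.+1 = (1 - w ^+ (m - j)) * qbin m j.
Proof.
elim: m j => [|m IH] j.
  by rewrite leqn0 => /eqP->; rewrite /= mulr0 subn0 expr0 subrr mul0r.
rewrite leq_eqVlt => /predU1P[->|].
  by rewrite qbin_small // subnn expr0 subrr mulr0 mul0r.
rewrite ltnS => jm.
have E : (1 - w ^+ j.+1) * qbin m.+1 j.+1 = (1 - w ^+ m.+1) * qbin m j.
  rewrite /= mulrDr mulrCA IH // mulrA -mulrDl; congr (_ * _).
  by rewrite mulrBr mulr1 -exprD addSn subnKC // addrC addrA subrK.
rewrite E; case: j jm {E} => [|j] jm; first by rewrite qbin0 subn0 qbin0.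
rewrite subSS /= mulrDr mulrCA -IH 1?ltnW // mulrA -mulrDl; congr (_ * _).
by rewrite mulrBr mulr1 -exprD addSn subnKC 1?ltnW // [RHS]addrC addrA subrK.
Qed.

Lemma qbin_root j : (0 < j < n)%N -> qbin n j = 0.
Proof.
case: j => // j /= jn.
have nz i : (i.+1 < n)%N -> 1 - w ^+ i.+1 != 0.
  move=> hi; rewrite subr_eq0 eq_sym -(prim_order_dvd hw).
  by apply/negP => /(dvdn_leq (ltn0Sn i)); rewrite leqNgt hi.
elim: j jn => [|j IH] jn; apply: (mulfI (nz _ jn)); rewrite mulr0 qbin_ratio.
- by rewrite subn0 (prim_expr_order hw) subrr mul0r.
- exact: ltnW (ltnW jn).
- by rewrite IH ?mulr0 // ltnW.
- exact: ltnW (ltnW jn).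
Qed.

Variable A : falgType k.
Implicit Types a b u v : A.

Lemma qcomm_exp (c : k) a b i j : b * a = c *: (a * b) ->
  b ^+ j * a ^+ i = c ^+ (j * i) *: (a ^+ i * b ^+ j).
Proof.
move=> ba.
have E i' : b * a ^+ i' = c ^+ i' *: (a ^+ i' * b).
  elim: i' => [|m IH]; first by rewrite !expr0 mulr1 mul1r scale1r.
  rewrite [a ^+ _]exprS mulrA ba -scalerAl -[a * b * _]mulrA IH.
  by rewrite -scalerAr scalerA -[c * _]exprS mulrA.
elim: j => [|j IH]; first by rewrite !expr0 mulr1 mul1r scale1r.
rewrite [b ^+ _]exprS -[b * _ * _]mulrA IH -scalerAr [b * (_ * _)]mulrA E.
rewrite -scalerAl scalerA -exprD -[a ^+ i * _ * _]mulrA -exprS.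
by rewrite mulSn addnC.
Qed.

Lemma qbinomial u v m : u * v = w *: (v * u) ->
  (u + v) ^+ m = \sum_(j < m.+1) qbin m j *: (v ^+ j * u ^+ (m - j)).
Proof.
move=> uv; elim: m => [|m IH].
  by rewrite big_ord1 /= !expr0 scale1r mulr1.
rewrite exprS IH mulrDl; transitivity (\sum_(j < m.+2)
    (w ^+ j * qbin m j) *: (v ^+ j * u ^+ (m.+1 - j)) +
    \sum_(j < m.+1) qbin m j *: (v ^+ j.+1 * u ^+ (m - j))).
  rewrite [X in _ = X + _]big_ord_recr /= (qbin_small (ltnSn m)).
  rewrite mulr0 scale0r addr0 !mulr_sumr; congr (_ + _); apply: eq_bigr => j _.
    have jm : (j <= m)%N by rewrite -ltnS.
    have E := @qcomm_exp w v u j 1 uv; rewrite !expr1 mul1n in E.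
    rewrite -scalerAr mulrA E -scalerAl scalerA mulrC -mulrA -exprS.
    by rewrite subSn.
  by rewrite -scalerAr exprS mulrA.
rewrite big_ord_recl [RHS]big_ord_recl /= !qbin0 expr0 mulr1 -addrA.
congr (_ + _); rewrite -big_split; apply: eq_bigr => j _ /=.
by rewrite -scalerDl subSS.
Qed.

Lemma qbinomial_root u v : u * v = w *: (v * u) -> u ^+ n = 0 -> v ^+ n = 0 ->
  (u + v) ^+ n = 0.
Proof.
move=> uv un vn; rewrite qbinomial // big1 // => j _.
have [j0|j0] := posnP j; first by rewrite j0 subn0 un mulr0 scaler0.
have [jn|jn] := ltnP j n; first by rewrite qbin_root ?j0 // scale0r.
have -> : nat_of_ord j = n by apply/eqP; rewrite eqn_leq jn -ltnS ltn_ord.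
by rewrite vn mul0r scaler0.
Qed.

End QBinomial.

Section TaftAlgebra.
Variables (k : fieldType) (n : nat) (w : k) (hw : n.-primitive_root w).

(* The entry of index (i, j) is the coefficient of g^i x^j; the primitivity   *)
(* of w is a parameter because the product is not associative without it.     *)
Definition taft_alg of n.-primitive_root w : Type := 'M[k]_n.
Local Notation T := (taft_alg hw).
HB.instance Definition _ := Vector.on T.

(* g^i x^j for arbitrary exponents. *)
Definition taft_mono (i j : nat) : T :=
  \matrix_(a, b) ((a == (i %% n)%N :> nat) && (b == j :> nat))%:R.

Definition taft_ext (V : lmodType k) (phi : nat -> nat -> V) (M : T) : V :=
  \sum_a \sum_b (M a b : k) *: phi a b.

(* The product for which (g^i x^j)(g^i' x^j') = w^(j i') g^(i + i') x^(j + j'). *)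
Definition taft_mul (M N : T) : T :=
  taft_ext (fun i j => taft_ext (fun i' j' =>
    w ^+ (j * i') *: taft_mono (i + i') (j + j')) N) M.

Let n_gt0 : (0 < n)%N := prim_order_gt0 hw.

Fact taft_ext_linear (V : lmodType k) (phi : nat -> nat -> V) :
  linear (taft_ext phi).
Proof.
move=> c t u; rewrite /taft_ext scaler_sumr -big_split; apply: eq_bigr => i _ /=.
rewrite scaler_sumr -big_split; apply: eq_bigr => j _ /=.
by rewrite !mxE scalerDl scalerA.
Qed.

HB.instance Definition _ (V : lmodType k) (phi : nat -> nat -> V) :=
  GRing.isSemilinear.Build k T V _ (taft_ext phi)
    (GRing.semilinear_linear (taft_ext_linear phi)).

Definition mono_ok (V : lmodType k) (phi : nat -> nat -> V) :=
  (forall i j, phi (i %% n)%N j = phi i j) /\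
  (forall i j, (n <= j)%N -> phi i j = 0).

Lemma taft_extE (V : lmodType k) (phi : nat -> nat -> V) i j :
  mono_ok phi -> taft_ext phi (taft_mono i j) = phi i j.
Proof.
case=> phim phi0; rewrite /taft_ext.
have lt_i : (i %% n < n)%N by rewrite ltn_mod.
rewrite (bigD1 (Ordinal lt_i)) //= [X in _ + X]big1 ?addr0; last first.
  move=> a /negPf na; apply: big1 => b _; rewrite mxE.
  by rewrite -[a == _ :> nat]/(a == Ordinal lt_i) na scale0r.
have [lt_j|le_j] := ltnP j n; last first.
  rewrite phi0 // big1 // => b _; rewrite mxE.
  by rewrite (ltn_eqF (leq_trans (ltn_ord b) le_j)) andbF scale0r.
rewrite (bigD1 (Ordinal lt_j)) //= [X in _ + X]big1 ?addr0; last first.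
  move=> b /negPf nb; rewrite mxE.
  by rewrite -[b == _ :> nat]/(b == Ordinal lt_j) nb andbF scale0r.
by rewrite mxE !eqxx scale1r phim.
Qed.

Lemma taft_mono_ok : mono_ok taft_mono.
Proof.
split=> i j; first by apply/matrixP => a b; rewrite !mxE modn_mod.
move=> le_j; apply/matrixP => a b; rewrite !mxE.
by rewrite (ltn_eqF (leq_trans (ltn_ord b) le_j)) andbF.
Qed.

Lemma taft_span M : M = taft_ext taft_mono M.
Proof.
apply/matrixP => a b; rewrite /taft_ext summxE (bigD1 a) //= summxE (bigD1 b) //=.
rewrite !mxE modn_small // !eqxx /= mulr1.
rewrite big1 ?addr0 => [|j /negPf nj]; last first.
  by rewrite !mxE [b == j :> nat]eq_sym -[j == b :> nat]/(j == b) nj andbF mulr0.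
rewrite big1 ?addr0 // => i /negPf ni; rewrite summxE big1 // => j _.
by rewrite !mxE modn_small // [a == i :> nat]eq_sym -[i == a :> nat]/(i == a) ni mulr0.
Qed.

Lemma taft_dim : \dim {:T} = (n ^ 2)%N.
Proof. by rewrite dimvf /dim /= mulnn. Qed.

Lemma taft_mono_ext (V : lmodType k) (f f' : T -> V) :
    linear f -> linear f' ->
  (forall i j, (i < n)%N -> (j < n)%N -> f (taft_mono i j) = f' (taft_mono i j)) ->
  f =1 f'.
Proof.
move=> fl fl' ff' M.
pose F := GRing.isSemilinear.Build k T V _ f (GRing.semilinear_linear fl).
pose F' := GRing.isSemilinear.Build k T V _ f' (GRing.semilinear_linear fl').
pose g : {linear T -> V} := HB.pack f F.
pose g' : {linear T -> V} := HB.pack f' F'.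
rewrite -[f]/(g : _ -> _) -[f']/(g' : _ -> _) (taft_span M) /taft_ext !linear_sum.
apply: eq_bigr => i _; rewrite !linear_sum; apply: eq_bigr => j _.
by rewrite !linearZ /= ff'.
Qed.

Fact taft_mul_ok1 i j : mono_ok (fun i' j' =>
  w ^+ (j * i') *: taft_mono (i + i') (j + j')).
Proof.
have [mm m0] := taft_mono_ok; split=> i' j'.
  rewrite -(mm _ (j + j')%N) modnDmr mm; congr (_ *: _).
  by rewrite -(prim_expr_mod hw) modnMmr prim_expr_mod.
by move=> le; rewrite m0 ?scaler0 // (leq_trans le) // leq_addl.
Qed.

Fact taft_mul_ok2 N : mono_ok (fun i j => taft_ext (fun i' j' =>
  w ^+ (j * i') *: taft_mono (i + i') (j + j')) N).
Proof.
have [mm m0] := taft_mono_ok; split=> i j.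
  apply: eq_bigr => i' _; apply: eq_bigr => j' _.
  by rewrite -(mm _ (j + j')%N) modnDml mm.
move=> le; apply: big1 => i' _; apply: big1 => j' _.
by rewrite m0 ?scaler0 // (leq_trans le) // leq_addr.
Qed.

Fact taft_mulE i j i' j' :
  taft_mul (taft_mono i j) (taft_mono i' j') =
  w ^+ (j * i') *: taft_mono (i + i') (j + j').
Proof.
rewrite /taft_mul taft_extE; last exact: taft_mul_ok2.
by rewrite taft_extE //; apply: taft_mul_ok1.
Qed.

Fact taft_mul_bilin : bilin taft_mul.
Proof.
split=> [N|M] c x y; first exact: taft_ext_linear.
move: M; apply: taft_mono_ext => [||i j _ _]; first exact: taft_ext_linear.
  by apply: linear_comb; exact: taft_ext_linear.
by rewrite /taft_mul !taft_extE ?taft_ext_linear //; exact: taft_mul_ok2.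
Qed.

Let mull N : linear (taft_mul^~ N). Proof. by case: taft_mul_bilin. Qed.
Let mulr M : linear (taft_mul M). Proof. by case: taft_mul_bilin. Qed.
Let mullZ c M N : taft_mul (c *: M) N = c *: taft_mul M N.
Proof.
have E0 : taft_mul 0 N = 0.
  have := mull N (-1) 0 0; rewrite scaleN1r oppr0 addr0 => ->.
  by rewrite scaleN1r addNr.
by have := mull N c M 0; rewrite E0 !addr0.
Qed.
Let mulrZ c M N : taft_mul M (c *: N) = c *: taft_mul M N.
Proof.
have E0 : taft_mul M 0 = 0.
  have := mulr M (-1) 0 0; rewrite scaleN1r oppr0 addr0 => ->.
  by rewrite scaleN1r addNr.
by have := mulr M c N 0; rewrite E0 !addr0.
Qed.

Fact taft_mulA : associative taft_mul.
Proof.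
move=> M N P; move: M; apply: taft_mono_ext => [||i j _ _]; first exact: mull.
  by move=> c x y; rewrite !mull.
move: N; apply: taft_mono_ext => [||i' j' _ _].
- by move=> c x y; rewrite mull mulr.
- by move=> c x y; rewrite mulr mull.
move: P; apply: taft_mono_ext => [||i2 j2 _ _].
- by move=> c x y; rewrite !mulr.
- by move=> c x y; rewrite !mulr.
rewrite !taft_mulE mullZ mulrZ !taft_mulE !scalerA -!exprD !addnA.
by congr (w ^+ _ *: _); rewrite mulnDl mulnDr [LHS]addnC addnA.
Qed.

Fact taft_mul1 : left_id (taft_mono 0 0) taft_mul.
Proof.
apply: taft_mono_ext => [|//|i j _ _]; first exact: mulr.
by rewrite taft_mulE mul0n expr0 scale1r.
Qed.

Fact taft_1mul : right_id (taft_mono 0 0) taft_mul.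
Proof.
apply: taft_mono_ext => [|//|i j _ _]; first exact: mull.
by rewrite taft_mulE muln0 expr0 scale1r !addn0.
Qed.

Fact taft_mulDl : left_distributive taft_mul +%R.
Proof. by move=> t u v; have := mull v 1 t u; rewrite !scale1r. Qed.

Fact taft_mulDr : right_distributive taft_mul +%R.
Proof. by move=> t u v; have := mulr t 1 u v; rewrite !scale1r. Qed.

Fact taft_1neq0 : taft_mono 0 0 != 0.
Proof.
apply/eqP => /matrixP /(_ (Ordinal n_gt0) (Ordinal n_gt0)) /eqP.
by rewrite !mxE mod0n oner_eq0.
Qed.

HB.instance Definition _ := GRing.Zmodule_isNzRing.Build T
  taft_mulA taft_mul1 taft_1mul taft_mulDl taft_mulDr taft_1neq0.

Fact taft_scaleAl c (M N : T) : c *: (M * N) = (c *: M) * N.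
Proof. by rewrite [RHS]mullZ. Qed.
HB.instance Definition _ := GRing.Lmodule_isLalgebra.Build k T taft_scaleAl.

Fact taft_scaleAr c (M N : T) : c *: (M * N) = M * (c *: N).
Proof. by rewrite [RHS]mulrZ. Qed.
HB.instance Definition _ := GRing.Lalgebra_isAlgebra.Build k T taft_scaleAr.
HB.instance Definition _ := Algebra_isFalgebra.Build k T.

Lemma taft_monoM i j i' j' :
  taft_mono i j * taft_mono i' j' =
  w ^+ (j * i') *: taft_mono (i + i') (j + j').
Proof. exact: taft_mulE. Qed.

Definition taft_g : T := taft_mono 1 0.
Definition taft_x : T := taft_mono 0 1.

Lemma taft_gX i : taft_g ^+ i = taft_mono i 0.
Proof.
elim: i => [|i IH]; first by [].
by rewrite exprS IH taft_monoM mul0n expr0 scale1r.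
Qed.

Lemma taft_xX j : taft_x ^+ j = taft_mono 0 j.
Proof.
elim: j => [|j IH]; first by [].
by rewrite exprS IH taft_monoM muln0 expr0 scale1r.
Qed.

Lemma taft_monoE i j : taft_mono i j = taft_g ^+ i * taft_x ^+ j.
Proof. by rewrite taft_gX taft_xX taft_monoM mul0n expr0 scale1r addn0. Qed.

Lemma taft_gn : taft_g ^+ n = 1.
Proof. by have [mm _] := taft_mono_ok; rewrite taft_gX -mm modnn. Qed.

Lemma taft_xn : taft_x ^+ n = 0.
Proof. by have [_ m0] := taft_mono_ok; rewrite taft_xX m0. Qed.

Lemma taft_xg : taft_x * taft_g = w *: (taft_g * taft_x).
Proof. by rewrite !taft_monoM mul1n mul0n expr0 scale1r expr1. Qed.

Lemma taft_gunit : taft_g \is a GRing.unit.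
Proof. by rewrite -(unitrX_pos _ n_gt0) taft_gn unitr1. Qed.

(* The universal property of the presentation by generators and relations. *)
Section Lift.
Variables (A : falgType k) (a b : A).
Hypotheses (an : a ^+ n = 1) (bn : b ^+ n = 0) (ba : b * a = w *: (a * b)).

Fact taft_lift_ok : mono_ok (fun i j => a ^+ i * b ^+ j).
Proof.
split=> i j; first by rewrite expr_mod.
by move=> le; rewrite -(subnKC le) exprD bn mul0r mulr0.
Qed.

Fact taft_lift_one : taft_ext (fun i j => a ^+ i * b ^+ j) 1 = 1.
Proof. by rewrite [LHS]taft_extE ?mulr1 //; exact: taft_lift_ok. Qed.

Fact taft_lift_mul : {morph taft_ext (fun i j => a ^+ i * b ^+ j) : M N / M * N}.
Proof.
have lin := taft_ext_linear (fun i j => a ^+ i * b ^+ j).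
move=> M N; move: M; apply: taft_mono_ext => [||i j _ _].
- by move=> c x y; rewrite mulrDl -scalerAl lin.
- by move=> c x y; rewrite lin mulrDl -scalerAl.
move: N; apply: taft_mono_ext => [||i' j' _ _].
- by move=> c x y; rewrite mulrDr -scalerAr lin.
- by move=> c x y; rewrite lin mulrDr -scalerAr.
rewrite taft_monoM -[_ *: taft_mono _ _]addr0 lin.
rewrite -[X in _ + X]/(taft_ext _ 0).
rewrite (_ : taft_ext _ 0 = 0) ?addr0; last first.
  by apply: big1 => ? _; apply: big1 => ? _; rewrite mxE scale0r.
rewrite !taft_extE; try exact: taft_lift_ok.
rewrite -[RHS]mulrA [b ^+ j * _]mulrA (qcomm_exp _ _ ba).
by rewrite -scalerAl -scalerAr !exprD !mulrA.
Qed.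

Definition taft_lift : 'AHom(T, A) :=
  mk_ahom (taft_ext_linear _) taft_lift_one taft_lift_mul.

Lemma taft_lift_g : taft_lift taft_g = a.
Proof. by rewrite mk_ahomE taft_extE ?mulr1 //; exact: taft_lift_ok. Qed.

Lemma taft_lift_x : taft_lift taft_x = b.
Proof. by rewrite mk_ahomE taft_extE ?mul1r //; exact: taft_lift_ok. Qed.
End Lift.

Lemma taft_ahom_ext (A : falgType k) (f f' : 'AHom(T, A)) :
  f taft_g = f' taft_g -> f taft_x = f' taft_x -> f =1 f'.
Proof.
move=> fg fx; apply: taft_mono_ext => [||i j _ _]; try exact: linearP.
by rewrite taft_monoE !rmorphM !rmorphXn /= fg fx.
Qed.

End TaftAlgebra.

Section TaftHopf.
Variables (k : fieldType) (n : nat) (w : k) (hw : n.-primitive_root w).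
Local Notation T := (taft_alg hw).
Local Notation g := (taft_g hw).
Local Notation x := (taft_x hw).

Let n_gt0 : (0 < n)%N := prim_order_gt0 hw.
Let g_unit : g \is a GRing.unit := taft_gunit hw.

Let tensX (A B : falgType k) (a : A) (b : B) m :
  (a *t b) ^+ m = (a ^+ m) *t (b ^+ m) :> tensor A B.
Proof. by elim: m => [|m IH]; rewrite ?expr0 ?tens1 // !exprS IH tensM. Qed.

Let tensZl (A B : falgType k) c (a : A) (b : B) :
  (c *: a) *t b = c *: (a *t b) :> tensor A B.
Proof. by apply/matrixP=> i j; rewrite !mxE linearZ /= mulrA. Qed.

Let tensZr (A B : falgType k) c (a : A) (b : B) :
  a *t (c *: b) = c *: (a *t b) :> tensor A B.
Proof. by apply/matrixP=> i j; rewrite !mxE linearZ /= mulrCA. Qed.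

Let tens0l (A B : falgType k) (b : B) : (0 : A) *t b = 0 :> tensor A B.
Proof. by rewrite -[0 in LHS](scale0r 0) tensZl scale0r. Qed.

Let tens0r (A B : falgType k) (a : A) : a *t (0 : B) = 0 :> tensor A B.
Proof. by rewrite -[0 in LHS](scale0r 0) tensZr scale0r. Qed.

Let Dg : tensor T T := g *t g.
Let Dx : tensor T T := x *t 1 + g *t x.

Fact taft_Dgn : Dg ^+ n = 1. Proof. by rewrite tensX taft_gn tens1. Qed.

Fact taft_Dxn : Dx ^+ n = 0.
Proof.
apply: (qbinomial_root hw).
- by rewrite !tensM mul1r mulr1 taft_xg tensZl.
- by rewrite tensX taft_xn tens0l.
- by rewrite tensX taft_xn tens0r.
Qed.

Fact taft_Dxg : Dx * Dg = w *: (Dg * Dx).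
Proof.
rewrite mulrDl mulrDr !tensM !mul1r !mulr1 !taft_xg tensZl tensZr.
by rewrite scalerDr.
Qed.

Definition taft_comul : 'AHom(T, tensor T T) :=
  taft_lift hw taft_Dgn taft_Dxn taft_Dxg.

Lemma taft_comul_1 : taft_comul 1 = 1. Proof. exact: rmorph1. Qed.
Lemma taft_comul_g : taft_comul g = g *t g. Proof. exact: taft_lift_g. Qed.
Lemma taft_comul_x : taft_comul x = x *t 1 + g *t x.
Proof. exact: taft_lift_x. Qed.

Let e1n : (1 : k^o) ^+ n = 1. Proof. exact: expr1n. Qed.
Let e0n : (0 : k^o) ^+ n = 0. Proof. by rewrite expr0n gtn_eqF. Qed.
Let e01 : (0 : k^o) * 1 = w *: (1 * 0 : k^o).
Proof. by rewrite mul0r mulr0 scaler0. Qed.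

Definition taft_counit : 'AHom(T, k^o) := taft_lift hw e1n e0n e01.

Lemma taft_counit_1 : taft_counit 1 = 1. Proof. exact: rmorph1. Qed.
Lemma taft_counit_g : taft_counit g = 1. Proof. exact: taft_lift_g. Qed.
Lemma taft_counit_x : taft_counit x = 0. Proof. exact: taft_lift_x. Qed.

Fact taft_comulA h :
  tassoc T T T (tmap taft_comul \1 (taft_comul h)) =
  tmap \1 taft_comul (taft_comul h).
Proof.
pose I : 'AHom(T, T) := id_ahom T.
pose f := comp_ahom (tassoc_ahom T T T)
            (comp_ahom (tmap_ahom taft_comul I) taft_comul).
pose f' := comp_ahom (tmap_ahom I taft_comul) taft_comul.
have fE u : f u = tassoc T T T (tmap taft_comul \1 (taft_comul u)).
  by rewrite !comp_lfunE.
have fE' u : f' u = tmap \1 taft_comul (taft_comul u) by rewrite !comp_lfunE.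
rewrite -fE -fE'; move: h; apply: taft_ahom_ext; rewrite fE fE'.
  by rewrite taft_comul_g !tmapE taft_comul_g !id_lfunE tassocE.
rewrite taft_comul_x !linearD /= !tmapE !id_lfunE taft_comul_x taft_comul_g.
have [tl tr] := tens_bilin T T; have [tl' tr'] := tens_bilin (tensor T T) T.
have [_ tr2] := tens_bilin T (tensor T T).
have := tl' 1 1 (x *t 1) (g *t x); rewrite !scale1r => ->.
have := tr2 g 1 (x *t 1) (g *t x); rewrite !scale1r => ->.
by rewrite !linearD /= !tassocE taft_comul_1 -tens1 addrA.
Qed.

Fact taft_counitl h : tcounitl taft_counit (taft_comul h) = h.
Proof.
pose f := comp_ahom (tcounitl_ahom taft_counit) taft_comul.
pose f' : 'AHom(T, T) := id_ahom T.
have fE u : f u = tcounitl taft_counit (taft_comul u) by rewrite !comp_lfunE.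
have fE' u : f' u = u by rewrite id_lfunE.
rewrite -fE -[RHS]fE'; move: h; apply: taft_ahom_ext; rewrite fE fE'.
  by rewrite taft_comul_g tcounitlE taft_counit_g scale1r.
rewrite taft_comul_x linearD /= !tcounitlE taft_counit_g taft_counit_x.
by rewrite scale0r add0r scale1r.
Qed.

Fact taft_counitr h : tcounitr taft_counit (taft_comul h) = h.
Proof.
pose f := comp_ahom (tcounitr_ahom taft_counit) taft_comul.
pose f' : 'AHom(T, T) := id_ahom T.
have fE u : f u = tcounitr taft_counit (taft_comul u) by rewrite !comp_lfunE.
have fE' u : f' u = u by rewrite id_lfunE.
rewrite -fE -[RHS]fE'; move: h; apply: taft_ahom_ext; rewrite fE fE'.
  by rewrite taft_comul_g tcounitrE taft_counit_g scale1r.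
rewrite taft_comul_x linearD /= !tcounitrE taft_counit_1 taft_counit_x.
by rewrite scale0r addr0 scale1r.
Qed.

Definition taft_bialg : bialgebra k :=
  Bialgebra taft_comulA taft_counitl taft_counitr.

(* The antimultiplicative extension of S(g) = g^-1 and S(x) = - g^-1 x, see    *)
(* [taft_antipodeM] below.                                                     *)
Let Sg : T := g^-1.
Let Sx : T := - (g^-1 * x).

Let Sgn : Sg ^+ n = 1. Proof. by rewrite exprVn taft_gn invr1. Qed.

Let w0 : w != 0. Proof. by rewrite (prim_root_eq0 hw) gtn_eqF. Qed.

Let C : x * Sg = w^-1 *: (Sg * x).
Proof.
apply: (mulrI g_unit); apply: (mulIr g_unit).
rewrite -scalerAr -scalerAl mulrA -mulrA mulVr // mulr1 [g * (_ * _)]mulrA.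
rewrite divrr // mul1r taft_xg scalerA mulVf ?scale1r //.
Qed.

Let SgSx : Sg * Sx = w *: (Sx * Sg).
Proof.
rewrite mulrN mulNr scalerN -mulrA C -scalerAr scalerA mulfV //.
by rewrite scale1r.
Qed.

Let Sxn : Sx ^+ n = 0.
Proof.
have E m : exists c : k, (Sg * x) ^+ m = c *: (Sg ^+ m * x ^+ m).
  elim: m => [|m [c IH]]; first by exists 1; rewrite !expr0 mulr1 scale1r.
  exists (c * w^-1 ^+ m).
  rewrite exprSr IH -scalerAl -scalerA; congr (_ *: _).
  have D := qcomm_exp 1 m C; rewrite expr1 muln1 in D.
  rewrite -mulrA [x ^+ m * _]mulrA D -scalerAl -scalerAr exprSr [x ^+ _]exprSr.
  by rewrite !mulrA.
have [c Ec] := E n; rewrite /Sx -mulN1r exprMn_comm.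
  by rewrite Ec taft_xn mulr0 scaler0 mulr0.
by rewrite /GRing.comm mulN1r mulrN1.
Qed.

Fact taft_antipode_ok : mono_ok n (fun i j => Sx ^+ j * Sg ^+ i).
Proof.
split=> i j; first by rewrite expr_mod.
by move=> le; rewrite -(subnK le) exprD Sxn mulr0 mul0r.
Qed.

Definition taft_antipode : 'End(T) :=
  linfun (taft_ext (fun i j => Sx ^+ j * Sg ^+ i)).

Let S := taft_antipode.
Local Notation mono := (taft_mono hw).

Let SE i j : S (mono i j) = Sx ^+ j * Sg ^+ i.
Proof. by rewrite lfunE /= taft_extE //; exact: taft_antipode_ok. Qed.

Lemma taft_antipode_1 : S 1 = 1. Proof. by rewrite SE mulr1. Qed.
Lemma taft_antipode_g : S g = g^-1. Proof. by rewrite SE mul1r. Qed.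
Lemma taft_antipode_x : S x = - (g^-1 * x). Proof. by rewrite SE mulr1. Qed.

Lemma taft_antipodeM u v : S (u * v) = S v * S u.
Proof.
move: u; apply: taft_mono_ext => [||i j _ _].
- by move=> c y z; rewrite mulrDl -scalerAl linearP.
- by move=> c y z; rewrite linearP mulrDr -scalerAr.
move: v; apply: taft_mono_ext => [||i' j' _ _].
- by move=> c y z; rewrite mulrDr -scalerAr linearP.
- by move=> c y z; rewrite linearP mulrDl -scalerAl.
rewrite taft_monoM linearZ /= !SE -[RHS]mulrA [Sg ^+ i' * _]mulrA.
rewrite (qcomm_exp _ _ SgSx) -scalerAl -scalerAr mulnC; congr (_ *: _).
by rewrite addnC exprD [(i + i')%N]addnC exprD !mulrA.
Qed.

Let mSl : tensor T T -> T := tlift (fun a b => S a * b).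
Let mSr : tensor T T -> T := tlift (fun a b => a * S b).

Let mSlE a b : mSl (a *t b) = S a * b.
Proof.
rewrite /mSl tliftE //; split=> [d|d] c y z /=.
  by rewrite linearP mulrDl -scalerAl.
by rewrite mulrDr -scalerAr.
Qed.

Let mSrE a b : mSr (a *t b) = a * S b.
Proof.
rewrite /mSr tliftE //; split=> [d|d] c y z /=.
  by rewrite mulrDl -scalerAl.
by rewrite linearP mulrDr -scalerAr.
Qed.

Let mSl_lin : linear mSl. Proof. exact: tlift_is_linear. Qed.
Let mSr_lin : linear mSr. Proof. exact: tlift_is_linear. Qed.

Let mSlM t (c d : T) : mSl (t * (c *t d)) = S c * mSl t * d.
Proof.
move: t; apply: tens_ext => [||a b].
- by move=> e y z; rewrite mulrDl -scalerAl mSl_lin.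
- by move=> e y z; rewrite mSl_lin mulrDr mulrDl -scalerAr -scalerAl.
by rewrite tensM !mSlE taft_antipodeM !mulrA.
Qed.

Let mSrM (a b : T) u : mSr ((a *t b) * u) = a * mSr u * S b.
Proof.
move: u; apply: tens_ext => [||c d].
- by move=> e y z; rewrite mulrDr -scalerAr mSr_lin.
- by move=> e y z; rewrite mSr_lin mulrDr mulrDl -scalerAr -scalerAl.
by rewrite tensM !mSrE taft_antipodeM !mulrA.
Qed.

Let mSl_mul (e : k) t u : mSl t = e%:A -> mSl (t * u) = e *: mSl u.
Proof.
move=> te; move: u; apply: tens_ext => [||c d].
- by move=> s y z; rewrite mulrDr -scalerAr mSl_lin.
- by move=> s y z; rewrite mSl_lin scalerDr !scalerA mulrC.
by rewrite mSlM te mSlE -scalerAr -scalerAl mulr1.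
Qed.

Let mSr_mul (e : k) t u : mSr u = e%:A -> mSr (t * u) = e *: mSr t.
Proof.
move=> te; move: t; apply: tens_ext => [||c d].
- by move=> s y z; rewrite mulrDl -scalerAl mSr_lin.
- by move=> s y z; rewrite mSr_lin scalerDr !scalerA mulrC.
by rewrite mSrM te mSrE -scalerAr -scalerAl mulr1.
Qed.

(* An identity m (Delta h) = e(h) 1 need only be checked on the generators. *)
Let conv_ext (m : tensor T T -> T) : linear m -> m 1 = 1 ->
    (forall t u e e', m t = e%:A -> m u = e'%:A -> m (t * u) = (e * e')%:A) ->
    m (taft_comul g) = 1 -> m (taft_comul x) = 0 ->
  forall h, m (taft_comul h) = (taft_counit h : k)%:A.
Proof.
move=> ml m1 mM mg mx; apply: taft_mono_ext => [||i j _ _].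
- by move=> c y z; rewrite linearP ml.
- by move=> c y z; rewrite linearP /= scalerDl scalerA.
rewrite taft_monoE !rmorphM !rmorphXn /= taft_counit_g taft_counit_x.
apply: (mM).
  elim: i => [|i IH]; first by rewrite !expr0 m1 scale1r.
  by rewrite !exprS; apply: (mM) => //; rewrite mg scale1r.
elim: j => [|j IH]; first by rewrite !expr0 m1 scale1r.
by rewrite !exprS; apply: (mM) => //; rewrite mx scale0r.
Qed.

Fact taft_antipodel h :
  tlift (fun a b => taft_antipode a * b) (taft_comul h) = (taft_counit h : k)%:A.
Proof.
move: h; apply: (@conv_ext mSl) => //.
- by rewrite -tens1 mSlE taft_antipode_1 mulr1.
- by move=> t u e e' te ue; rewrite (mSl_mul _ te) ue scalerA.
- by rewrite taft_comul_g mSlE taft_antipode_g mulVr.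
rewrite taft_comul_x -[x *t 1]scale1r mSl_lin !mSlE taft_antipode_g.
by rewrite taft_antipode_x mulr1 scale1r addNr.
Qed.

Fact taft_antipoder h :
  tlift (fun a b => a * taft_antipode b) (taft_comul h) = (taft_counit h : k)%:A.
Proof.
move: h; apply: (@conv_ext mSr) => //.
- by rewrite -tens1 mSrE taft_antipode_1 mulr1.
- by move=> t u e e' te ue; rewrite (mSr_mul _ ue) te scalerA mulrC.
- by rewrite taft_comul_g mSrE taft_antipode_g divrr.
rewrite taft_comul_x -[x *t 1]scale1r mSr_lin !mSrE taft_antipode_1.
by rewrite taft_antipode_x mulr1 scale1r mulrN mulrA divrr // mul1r subrr.
Qed.

Definition taft : hopf_algebra k :=
  @HopfAlgebra k taft_bialg taft_antipode taft_antipodel taft_antipoder.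

End TaftHopf.

(* Main.v *)
(* Trace. S(g^i x^j) is a multiple of g^(-i-j) x^j, so only the pairs with     *)
(* 2i + j = 0 mod n contribute to Tr S. For n even the sum is twice the        *)
(* geometric sum of the w^l, l < n/2, i.e. 4 / (1 - w); for n odd it is the    *)
(* geometric sum of the (-p)^j, j < n, with p = w^((n+1)/2) the square root of *)
(* w among the powers of w, i.e. 2 / (1 + p). Both values determine w.         *)
(*                                                                            *)
(* Gauge equivalence. For n > 1 let E be the nonsplit two-dimensional          *)
(* representation with diagonal characters the counit and chi : g |-> w^-1.    *)
(* The representations chi (x) E and E (x) chi, both with diagonal characters  *)
(* chi and chi^2, are intertwined by E(g), of diagonal (1, w^-1). Twisting by  *)
(* F multiplies the intertwiner by lower triangular matrices whose diagonals,  *)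
(* (1, (chi (x) chi)(F)) and its inverse, cancel. Hence w1^-1 is still seen in *)
(* the twist; there it is the value of chi at the second Taft generator g,     *)
(* which the relation xg = w2 gx forces to be w2^-1.                           *)

Require Import Defs.
From HB Require Import structures.
From mathcomp Require Import all_boot all_order all_algebra.
From mathcomp Require Import falgebra.
From mathcomp Require Import zify ring.

Set Implicit Arguments.
Unset Strict Implicit.
Unset Printing Implicit Defensive.

Import GRing.Theory.
Local Open Scope ring_scope.

(** Each invariant recovers the root. By [taft_antipode_trace_odd] and [taft_antipode_trace_even],
    Tr S times [1 + p] or [1 - w] is 2 or 4, which is nonzero in characteristic zero. Equal traces
    thus have equal cofactors, and these determine [w] ([taft_antipode_trace_root]). For gauge
    equivalence, [ext_rep_braid] provides the intertwiner and [taft_twist_root] carries it through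
    the twist. With [c] the value of chi at the image of the second generator [g], the intertwiner
    gives [c * w1 = 1] and the relation between the generators gives [c * w2 = 1]. For [n = 1] the
    only root is 1. Conversely, equal roots give the same Hopf algebra, which is its own twist by
    the cocycle 1. *)

(** * Traces in a chosen spanning family *)

(** [lfun_trace] refers to the basis [vbasis], which is awkward for computation. Expanding its
    vectors in the [v i] and exchanging the sums replaces it by any family with coordinate
    functionals, here the monomials. *)
Lemma lfun_trace_coord (k : fieldType) (V : vectType k) (I : finType)
    (v : I -> V) (phi : I -> {linear V -> k^o}) (f : 'End(V)) :
  (forall u, u = \sum_i (phi i u : k) *: v i) ->
  lfun_trace f = \sum_i (phi i (f (v i)) : k).
Proof.
move=> v_span; set b := vbasis {:V}.
have -> : lfun_trace f = \sum_(a < \dim {:V}) coord b a (f b`_a).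
  apply: eq_bigr => a _.
  by rewrite /passmx.mxof mxE /= passmx.vecof_delta mxE.
transitivity (\sum_(a < \dim {:V}) \sum_i
    (phi i b`_a : k) * coord b a (f (v i))).
  apply: eq_bigr => a _; rewrite {1}(v_span b`_a) !linear_sum.
  by apply: eq_bigr => i _; rewrite !linearZ.
rewrite exchange_big; apply: eq_bigr => i _ /=.
rewrite {2}(coord_vbasis (memvf (f (v i)))) linear_sum.
by apply: eq_bigr => a _; rewrite linearZ mulrC.
Qed.

Lemma sum_eqmod_const (R : nmodType) (m c : nat) (F : R) : (0 < m)%N ->
  \sum_(i < m | i == c %[mod m]) F = F.
Proof.
move=> m_gt0; rewrite (big_pred1 (Ordinal (ltn_pmod c m_gt0))) // => i.
by rewrite modn_small.
Qed.

(** * The antipode on monomials and its trace as a double sum *)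

Section AntipodeTrace.
Variables (k : fieldType) (n : nat) (w : k) (hw : n.-primitive_root w).
Local Notation S := (taft_antipode hw).
Local Notation mono := (taft_mono hw).

Let n_gt0 : (0 < n)%N := prim_order_gt0 hw.

Lemma prim_root_invE : w ^+ n.-1 = w^-1.
Proof.
have wn : w * w ^+ n.-1 = 1 by rewrite -exprS prednK ?prim_expr_order.
by apply: (mulfI (x := w)); rewrite ?wn ?divff // (prim_root_eq0 hw) gtn_eqF.
Qed.

Lemma taft_antipodeX u m : S (u ^+ m) = S u ^+ m.
Proof.
elim: m => [|m IH]; first by rewrite !expr0 taft_antipode_1.
by rewrite exprSr taft_antipodeM IH -exprS.
Qed.

Lemma taft_gV : (taft_g hw)^-1 = mono n.-1 0.
Proof.
rewrite -taft_gX; apply: (mulrI (taft_gunit hw)).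
by rewrite divrr ?taft_gunit // -exprS prednK // taft_gn.
Qed.

(** S reverses products, so the value is [(- g^-1 x)^j g^-i]. Collecting the powers of [g] in
    [(g^-1 x)^j] costs [w^-1] to the power ['C(j, 2)], and moving [g^-i] past [x^j] costs the power
    [i * j]. The factor [n.-1] plays the part of -1 in exponents of [g]. *)
Lemma taft_antipode_mono i j :
  S (mono i j) = ((-1) ^+ j * w^-1 ^+ ('C(j, 2) + i * j)) *:
    mono (n.-1 * (i + j)) j.
Proof.
have gXV : (taft_g hw)^-1 ^+ i = mono (n.-1 * i) 0.
  by rewrite taft_gV -taft_gX -exprM taft_gX.
have gxX : (mono n.-1 1) ^+ j = w^-1 ^+ 'C(j, 2) *: mono (n.-1 * j) j.
  elim: j => [|j IH]; first by rewrite muln0 scale1r.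
  rewrite exprS IH -scalerAr taft_monoM scalerA mul1n -mulnS exprM.
  by rewrite prim_root_invE -exprD binS bin1.
rewrite taft_monoE taft_antipodeM !taft_antipodeX taft_antipode_g.
rewrite taft_antipode_x taft_gV taft_monoM mul0n expr0 scale1r addn0 add0n.
rewrite [(- taft_mono _ _ _) ^+ _]exprNn gxX -taft_gV gXV -mulrA.
rewrite -scalerAl taft_monoM scalerA.
rewrite mulnCA exprM prim_root_invE -exprD addn0 -mulnDr addnC [(j * i)%N]mulnC.
rewrite [(j + i)%N]addnC -scalerA -[in LHS]signr_odd -[in RHS]signr_odd.
by rewrite mulr_sign scaler_sign addnC.
Qed.

Lemma taft_antipode_trace :
  lfun_trace (antipode (taft hw)) =
  \sum_(j < n) \sum_(i < n | (n %| i.*2 + j)%N)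
    (-1) ^+ j * w^-1 ^+ ('C(j, 2) + i * j).
Proof.
pose phi (p : 'I_n * 'I_n) (M : taft_alg hw) : k^o := M p.1 p.2.
have phi_lin p : linear (phi p) by move=> c M N; rewrite /phi !mxE.
pose Phi p : {linear taft_alg hw -> k^o} := HB.pack (phi p)
  (GRing.isSemilinear.Build k (taft_alg hw) k^o _ (phi p)
    (GRing.semilinear_linear (phi_lin p))).
rewrite (@lfun_trace_coord _ _ _ (fun p : 'I_n * 'I_n => mono p.1 p.2) Phi).
  rewrite -(pair_big predT predT (fun i j => Phi (i, j) (S (mono i j)) : k)).
  rewrite exchange_big; apply: eq_bigr => j _; rewrite [RHS]big_mkcond.
  apply: eq_bigr => i _; rewrite /= taft_antipode_mono /phi /= !mxE eqxx andbT.
  (* Adding [i + j] to both sides turns [n.-1 * (i + j)] into a multiple of [n], so the monomial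
     returns to itself exactly when [n] divides [2i + j]. *)
  rewrite -[X in X == _](modn_small (ltn_ord i)) -(eqn_modDr (i + j)).
  rewrite addnA addnn -mulSnr prednK // modnMr -/(dvdn _ _).
  by case: ifP => _; rewrite ?mulr1 ?mulr0.
by move=> M; rewrite {1}(taft_span M) /taft_ext pair_bigA.
Qed.
End AntipodeTrace.

(** * Evaluation of the trace for odd and for even [n] *)

Lemma sum_ord_double (R : nmodType) (G : nat -> R) m :
  \sum_(j < m.*2) G j = \sum_(l < m) (G l.*2 + G l.*2.+1).
Proof.
elim: m => [|m IH]; first by rewrite !big_ord0.
by rewrite doubleS !big_ord_recr /= IH addrA.
Qed.

Lemma bin2_double j : ('C(j, 2).*2 + j = j * j)%N.
Proof. by elim: j => // j; rewrite binS bin1; lia. Qed.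

Section TraceValue.
Variables (k : fieldType) (n : nat) (w : k) (hw : n.-primitive_root w).
Local Notation tr := (lfun_trace (antipode (taft hw))).

Let n_gt0 : (0 < n)%N := prim_order_gt0 hw.
Let w0 : w != 0. Proof. by rewrite (prim_root_eq0 hw) gtn_eqF. Qed.

Lemma prim_root_half_sq : odd n -> (w ^+ (n./2).+1) ^+ 2 = w.
Proof.
move=> n_odd; have n_half : (n./2.*2.+1 = n)%N.
  by rewrite -[RHS]odd_double_half n_odd.
by rewrite -exprM muln2 doubleS exprS n_half (prim_expr_order hw) mulr1.
Qed.

Lemma taft_antipode_trace_odd : odd n -> (1 + w ^+ (n./2).+1) * tr = 2%:R.
Proof.
set m := n./2; set p := w ^+ m.+1 => n_odd.
have nE : n = m.*2.+1 by rewrite -[LHS](odd_double_half n) n_odd.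
have pp : p ^+ 2 = w by exact: prim_root_half_sq.
have pn : p ^+ n = 1 by rewrite -exprM mulnC exprM (prim_expr_order hw) expr1n.
have p0 : p != 0 by rewrite expf_neq0.
rewrite taft_antipode_trace.
have -> : \sum_(j < n) \sum_(i < n | (n %| i.*2 + j)%N)
    (-1) ^+ j * w^-1 ^+ ('C(j, 2) + i * j) = \sum_(j < n) (- p) ^+ j.
  apply: eq_bigr => j _.
  (* Since [2m = n - 1], the solution of [2i + j = 0] modulo [n] is [i = m * j]. It is unique
     because [m.+1] is the inverse of 2. *)
  rewrite -[RHS](@sum_eqmod_const _ n (m * j)) //.
  apply: eq_big => [i|i].
    have n_coprime : coprime n m.+1.
      have := coprimenS n; rewrite {2}nE -[m.*2.+2]/(m.+1.*2) -muln2.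
      by rewrite coprimeMr => /andP[].
    rewrite -(Gauss_dvdr _ n_coprime) -(eqn_modDr (m.+1 * j)).
    rewrite -mulnDl [(m + _)%N]addnS addnn -nE modnMr -/(dvdn _ _).
    have -> : (m.+1 * (i.*2 + j) = n * i + (i + m.+1 * j))%N.
      by move: (i : nat) (j : nat) => i' j'; rewrite nE; lia.
    by rewrite dvdn_addr // dvdn_mulr.
  move=> /dvdnP[s sE]; rewrite [RHS]exprNn; congr (_ * _).
  (* 2 (C(j, 2) + ij) + j = j (2i + j) is a multiple of n. *)
  apply: (mulfI (expf_neq0 ('C(j, 2) + i * j) w0)).
  rewrite -exprMn divff // expr1n -pp -exprM -exprD.
  have -> : (2 * ('C(j, 2) + i * j) + j = n * (s * j))%N.
    by have := bin2_double j; nia.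
  by rewrite exprM pn expr1n.
(* A geometric sum, in which [(- p) ^+ n = -1] because [n] is odd. *)
have := subrX1 (- p) n; rewrite exprNn -signr_odd n_odd pn mulr1.
by move=> E; apply: oppr_inj; rewrite -mulNr opprD addrC -E; ring.
Qed.

Lemma taft_antipode_trace_even : ~~ odd n -> (1 - w) * tr = 4%:R.
Proof.
set m := n./2 => n_even.
have nE : n = m.*2 by rewrite -[LHS](odd_double_half n) (negPf n_even).
have m_gt0 : (0 < m)%N by rewrite -double_gt0 -nE.
have wm : w ^+ m = -1.
  have /eqP : (w ^+ m) ^+ 2 = 1 by rewrite -exprM muln2 -nE prim_expr_order.
  rewrite sqrf_eq1 => /orP[|/eqP //]; rewrite -(prim_order_dvd hw).
  by move=> /(dvdn_leq m_gt0); rewrite nE -addnn; lia.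
rewrite taft_antipode_trace.
have -> : \sum_(j < n) \sum_(i < n | (n %| i.*2 + j)%N)
    (-1) ^+ j * w^-1 ^+ ('C(j, 2) + i * j) = \sum_(l < m) (w ^+ l + w ^+ l).
  rewrite [in LHS]nE (sum_ord_double (fun j => \sum_(i < m.*2 | (_ %| _ + j)%N)
    (-1) ^+ j * w^-1 ^+ ('C(j, 2) + _ * j))); apply: eq_bigr => l _.
  (* An odd [j] contributes nothing: the even [n] cannot divide the odd [2i + j]. *)
  rewrite [X in _ + X]big1 ?addr0 => [|i]; last first.
    move=> dvd_odd; suff : (2 %| i.*2 + l.*2.+1)%N by rewrite dvdn2; lia.
    by apply: dvdn_trans dvd_odd; rewrite -muln2 dvdn_mull.
  have eval (i : nat) : (m %| i + l)%N ->
      (-1) ^+ l.*2 * w^-1 ^+ ('C(l.*2, 2) + i * l.*2) = w ^+ l.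
    move=> /dvdnP[s sE]; rewrite -signr_odd odd_double mul1r.
    apply: (mulfI (expf_neq0 ('C(l.*2, 2) + i * l.*2) w0)).
    rewrite -exprMn divff // expr1n -exprD.
    have -> : ('C(l.*2, 2) + i * l.*2 + l = n * (s * l))%N.
      by have := bin2_double l.*2; nia.
    by rewrite exprM (prim_expr_order hw) expr1n.
  have dvd_double i : (m.*2 %| i.*2 + l.*2)%N = (m %| i + l)%N.
    by rewrite -doubleD -!muln2 dvdn_pmul2r.
  rewrite -addnn big_split_ord /=.
  (* The range of [i] splits into two halves of length [m], with offset [c] equal to 0 or [m]. Each
     half holds one solution, [i = - l] modulo [m], which accounts for the factor 2. *)
  have inner (c : nat) : (m %| c)%N ->
      \sum_(i < m | (m + m %| (c + i).*2 + l.*2)%N)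
        (-1) ^+ l.*2 * w^-1 ^+ ('C(l.*2, 2) + (c + i) * l.*2) = w ^+ l.
    move=> mc; rewrite -[RHS](@sum_eqmod_const _ m (m.-1 * l)) //.
    apply: eq_big => [i|i]; last by rewrite addnn dvd_double => /eval.
    rewrite addnn dvd_double -addnA dvdn_addr // -(eqn_modDr l).
    by rewrite -mulSnr prednK // modnMr.
  by rewrite (inner m) // -{2}(inner 0%N).
rewrite big_split /=.
have := subrX1 w m; rewrite wm => E.
by rewrite mulrDr -opprB !mulNr -E; ring.
Qed.
End TraceValue.

Lemma ahomD (k : fieldType) (A B : falgType k) (f : 'AHom(A, B)) u v :
  f (u + v) = f u + f v.
Proof. exact: linearD. Qed.

Lemma ahomZ (k : fieldType) (A B : falgType k) (f : 'AHom(A, B)) c u :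
  f (c *: u) = c *: f u.
Proof. exact: linearZ. Qed.

Lemma ahomM (k : fieldType) (A B : falgType k) (f : 'AHom(A, B)) u v :
  f (u * v) = f u * f v.
Proof. exact: rmorphM. Qed.

(** * Tensoring a representation with a character *)

Section TensorMaps.
Variable k : fieldType.

Section ScalarTensor.
Variables (A B C : falgType k).

Fact tscalel_bilin (phi : 'AHom(A, k^o)) (psi : 'AHom(B, C)) :
  bilin (fun a b => (phi a : k) *: psi b).
Proof.
split=> [b|a] c u v /=; first by rewrite linearP /= scalerDl scalerA.
by rewrite linearP scalerDr !scalerA mulrC.
Qed.

Fact tscalel_is_ahom (phi : 'AHom(A, k^o)) (psi : 'AHom(B, C)) :
  ahom_in {:tensor A B} (linfun (tlift (fun a b => (phi a : k) *: psi b))).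
Proof.
have E a b : linfun (tlift (fun a b => (phi a : k) *: psi b)) (a *t b) =
    (phi a : k) *: psi b.
  by rewrite lfunE /= tliftE //; exact: tscalel_bilin.
apply/ahom_inP; split=> [u v _ _|]; last first.
  by rewrite -tens1 E !rmorph1 scale1r.
apply: tens_mult => a b a' b'; rewrite !E !rmorphM.
by rewrite -scalerAl -scalerAr scalerA.
Qed.

(** For a representation [psi], composing this with a comultiplication gives the representation
    [phi (x) psi]. Being multiplicative on the whole tensor algebra, it can also be applied to a
    twist [F]. *)
Definition tscalel phi psi : 'AHom(tensor A B, C) :=
  AHom (tscalel_is_ahom phi psi).

Lemma tscalelE phi psi a b : tscalel phi psi (a *t b) = (phi a : k) *: psi b.
Proof. by rewrite lfunE /= tliftE //; exact: tscalel_bilin. Qed.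
End ScalarTensor.

Section TensorScalar.
Variables (A B C : falgType k).

Fact tscaler_bilin (psi : 'AHom(A, C)) (phi : 'AHom(B, k^o)) :
  bilin (fun a b => (phi b : k) *: psi a).
Proof.
split=> [b|a] c u v /=; last by rewrite linearP /= scalerDl scalerA.
by rewrite linearP scalerDr !scalerA mulrC.
Qed.

Fact tscaler_is_ahom (psi : 'AHom(A, C)) (phi : 'AHom(B, k^o)) :
  ahom_in {:tensor A B} (linfun (tlift (fun a b => (phi b : k) *: psi a))).
Proof.
have E a b : linfun (tlift (fun a b => (phi b : k) *: psi a)) (a *t b) =
    (phi b : k) *: psi a.
  by rewrite lfunE /= tliftE //; exact: tscaler_bilin.
apply/ahom_inP; split=> [u v _ _|]; last first.
  by rewrite -tens1 E !rmorph1 scale1r.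
apply: tens_mult => a b a' b'; rewrite !E !rmorphM.
by rewrite -scalerAl -scalerAr scalerA.
Qed.

Definition tscaler psi phi : 'AHom(tensor A B, C) :=
  AHom (tscaler_is_ahom psi phi).

Lemma tscalerE psi phi a b : tscaler psi phi (a *t b) = (phi b : k) *: psi a.
Proof. by rewrite lfunE /= tliftE //; exact: tscaler_bilin. Qed.
End TensorScalar.
End TensorMaps.

(** * Intertwiners and characters of Taft algebras *)

Section Intertwiners.
Variables (k : fieldType) (n : nat) (w : k) (hw : n.-primitive_root w).
Variables (A : falgType k).

(** The elements [u] satisfying the relation form a subalgebra, so the generators suffice. *)
Lemma taft_intertwine (phi psi : 'AHom(taft_alg hw, A)) (c : A) :
  phi (taft_g hw) * c = c * psi (taft_g hw) ->
  phi (taft_x hw) * c = c * psi (taft_x hw) ->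
  forall u, phi u * c = c * psi u.
Proof.
have expE u m : phi u * c = c * psi u -> phi u ^+ m * c = c * psi u ^+ m.
  move=> E; elim: m => [|m IH]; first by rewrite !expr0 mul1r mulr1.
  by rewrite exprSr -mulrA E mulrA IH -mulrA -exprSr.
move=> Eg Ex; apply: taft_mono_ext => [||i j _ _].
- by move=> d u v; rewrite linearP mulrDl scalerAl.
- by move=> d u v; rewrite linearP mulrDr scalerAr.
by rewrite taft_monoE !rmorphM !rmorphXn /= -mulrA expE // mulrA expE // mulrA.
Qed.

(** The image is generated by [phi g] alone. Taking both maps equal to [phi] makes [taft_intertwine]
    a centralizer criterion, applied to [phi g] and then to any [phi v]. *)
Lemma taft_image_commutative (phi : 'AHom(taft_alg hw, A)) :
  phi (taft_x hw) = 0 -> forall u v, phi u * phi v = phi v * phi u.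
Proof.
move=> x0 u v.
have gC t : phi t * phi (taft_g hw) = phi (taft_g hw) * phi t.
  by apply: taft_intertwine; rewrite ?x0 ?mul0r ?mulr0.
by apply: taft_intertwine; rewrite ?x0 ?mul0r ?mulr0.
Qed.

Lemma taft_character_x (chi : 'AHom(taft_alg hw, k^o)) : chi (taft_x hw) = 0.
Proof.
have : chi (taft_x hw) ^+ n = 0 by rewrite -rmorphXn /= taft_xn raddf0.
by move/eqP; rewrite expf_eq0 => /andP[_ /eqP].
Qed.
End Intertwiners.

Section Matrices2.
Variable R : nzRingType.
Implicit Types M N : 'M[R]_2.

Lemma mulmx2E M N i j : (M * N) i j = M i 0 * N 0 j + M i 1 * N 1 j.
Proof.
rewrite mxE !big_ord_recl big_ord0 addr0.
by congr (_ + M _ _ * N _ _); apply: val_inj.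
Qed.

Lemma eq_mx2 M N : M 0 0 = N 0 0 -> M 0 1 = N 0 1 ->
  M 1 0 = N 1 0 -> M 1 1 = N 1 1 -> M = N.
Proof.
have two (i : 'I_2) : i = 0 \/ i = 1.
  by case: i => [[|[|//]] ?]; [left | right]; apply: val_inj.
by move=> *; apply/matrixP=> i j; case: (two i) => ->; case: (two j) => ->.
Qed.
End Matrices2.

(** * The nonsplit extension of chi and the counit *)

Section Extension.
Variables (k : fieldType) (n : nat) (w : k) (hw : n.-primitive_root w).
Hypothesis n_gt1 : (1 < n)%N.
Local Notation T := (taft_alg hw).
Local Notation g := (taft_g hw).
Local Notation x := (taft_x hw).
Local Notation eps := (taft_counit hw).
Local Notation arith01 :=
  (mulr0, mul0r, addr0, add0r, mulr1, mul1r, expr0, expr1).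

Let w0 : w != 0. Proof. by rewrite (prim_root_eq0 hw) gtn_eqF // ltnW. Qed.

(** Here [x] sends the first basis vector to the second and kills the second; [x g = w g x] then
    forces the ratio [w^-1] of the eigenvalues of [g]. *)
Let Eg : 'M[k]_2 := \matrix_(i, j) ((i == j)%:R * w^-1 ^+ i).
Let Ex : 'M[k]_2 := delta_mx 1 0.

Let Egn : Eg ^+ n = 1.
Proof.
have -> m : Eg ^+ m = \matrix_(i, j) ((i == j)%:R * w^-1 ^+ (i * m)).
  elim: m => [|m IH].
    by apply/matrixP=> i j; rewrite expr0 !mxE muln0 mulr1.
  rewrite exprS IH; apply: eq_mx2; rewrite mulmx2E !mxE /= ?mulr0 ?mul0r;
  rewrite ?addr0 ?add0r ?mul0r ?mul0n ?expr0 ?mulr0 ?mulr1 ?mul1r // expr1.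
  by rewrite !mul1n exprS.
apply/matrixP=> i j; rewrite !mxE mulnC exprM exprVn (prim_expr_order hw).
by rewrite invr1 expr1n mulr1.
Qed.

Let Exn : Ex ^+ n = 0.
Proof.
rewrite -(subnKC n_gt1) exprD expr2.
suff -> : Ex * Ex = 0 by rewrite mul0r.
by apply: eq_mx2; rewrite mulmx2E !mxE /= ?mulr0 ?mul0r ?addr0.
Qed.

Let Exg : Ex * Eg = w *: (Eg * Ex).
Proof.
apply: eq_mx2; rewrite [RHS]mxE !mulmx2E !mxE /= ?arith01 //.
by rewrite divff.
Qed.

Definition taft_ext_rep : 'AHom(T, 'M[k]_2) := taft_lift hw Egn Exn Exg.

Let chin : (w^-1 : k^o) ^+ n = 1.
Proof. by rewrite exprVn (prim_expr_order hw) invr1. Qed.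
Let chi0 : (0 : k^o) ^+ n = 0.
Proof. by rewrite expr0n gtn_eqF // ltnW. Qed.
Let chi0g : (0 : k^o) * w^-1 = w *: (w^-1 * 0 : k^o).
Proof. by rewrite mul0r mulr0 scaler0. Qed.

Definition taft_ext_char : 'AHom(T, k^o) := taft_lift hw chin chi0 chi0g.

Local Notation E := taft_ext_rep.
Local Notation chi := taft_ext_char.

Lemma taft_ext_rep_g : E g = Eg. Proof. exact: taft_lift_g. Qed.
Lemma taft_ext_rep_x : E x = Ex. Proof. exact: taft_lift_x. Qed.
Lemma taft_ext_char_g : chi g = w^-1. Proof. exact: taft_lift_g. Qed.

Fact scalar_linear (A : falgType k) : linear (fun c : k^o => (c : k)%:A : A).
Proof. by move=> c u v; rewrite scalerDl scalerA. Qed.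
Fact scalar_mul (A : falgType k) :
  {morph (fun c : k^o => (c : k)%:A : A) : u v / u * v}.
Proof. by move=> u v; rewrite -scalerAl mul1r scalerA. Qed.
(** Turns characters into scalar matrices, so that [taft_intertwine] can compare them with [E]. *)
Let scal : 'AHom(k^o, 'M[k]_2) :=
  mk_ahom (@scalar_linear 'M[k]_2) (scale1r 1) (@scalar_mul 'M[k]_2).

Let E_row0 u : ((eps u : k)%:A : 'M[k]_2) * delta_mx 0 0 = delta_mx 0 0 * E u.
Proof.
have scalE v : comp_ahom scal eps v = (eps v : k)%:A.
  by rewrite comp_lfunE mk_ahomE.
rewrite -scalE; apply: taft_intertwine; rewrite scalE.
  rewrite taft_counit_g taft_ext_rep_g; apply: eq_mx2;
  by rewrite !mulmx2E !mxE /= ?arith01.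
rewrite taft_counit_x taft_ext_rep_x; apply: eq_mx2;
by rewrite !mulmx2E !mxE /= ?arith01.
Qed.

Let E_col1 u : E u * delta_mx 1 1 = delta_mx 1 1 * ((chi u : k)%:A : 'M[k]_2).
Proof.
have scalE v : comp_ahom scal chi v = (chi v : k)%:A.
  by rewrite comp_lfunE mk_ahomE.
rewrite -scalE; apply: taft_intertwine; rewrite scalE.
  rewrite taft_ext_char_g taft_ext_rep_g; apply: eq_mx2;
  by rewrite !mulmx2E !mxE /= ?arith01.
rewrite taft_character_x taft_ext_rep_x; apply: eq_mx2;
by rewrite !mulmx2E !mxE /= ?arith01.
Qed.

Lemma taft_ext_rep00 u : E u 0 0 = eps u.
Proof.
have /matrixP/(_ 0 0) := E_row0 u.
by rewrite !mulmx2E !mxE /= !mulr1 mulr0 mul1r mul0r !addr0.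
Qed.

Lemma taft_ext_rep01 u : E u 0 1 = 0.
Proof.
have /matrixP/(_ 0 1) := E_row0 u.
by rewrite !mulmx2E !mxE /= !mulr0 mul1r mul0r !addr0.
Qed.

Lemma taft_ext_rep11 u : E u 1 1 = chi u.
Proof.
have /matrixP/(_ 1 1) := E_col1 u.
by rewrite !mulmx2E !mxE /= !mulr1 mulr0 mul1r mul0r !add0r.
Qed.

Local Notation R := (tscalel chi E).
Local Notation L := (tscaler E chi).

(** Through this entry the counit normalization of [F] gives [R F 0 0 = 1]. *)
Lemma ext_rep_right00 t : R t 0 0 = chi (tcounitr eps t).
Proof.
move: t; apply: (@tens_ext k T T k^o) => [c u v|c u v|a b].
- by rewrite linearP !mxE.
- by rewrite !linearP.
by rewrite tscalelE tcounitrE linearZ mxE taft_ext_rep00 /= mulrC.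
Qed.

Lemma ext_rep_right01 t : R t 0 1 = 0.
Proof.
move: t; apply: (@tens_ext k T T k^o) => [c u v|c u v|a b].
- by rewrite linearP !mxE.
- by rewrite scaler0 addr0.
by rewrite tscalelE mxE taft_ext_rep01 mulr0.
Qed.

Lemma ext_rep_right11 t : R t 1 1 = tscalel chi chi t.
Proof.
move: t; apply: (@tens_ext k T T k^o) => [c u v|c u v|a b].
- by rewrite linearP !mxE.
- by rewrite !linearP.
by rewrite !tscalelE mxE taft_ext_rep11.
Qed.

Lemma ext_rep_left00 t : L t 0 0 = chi (tcounitl eps t).
Proof.
move: t; apply: (@tens_ext k T T k^o) => [c u v|c u v|a b].
- by rewrite linearP !mxE.
- by rewrite !linearP.
by rewrite tscalerE tcounitlE linearZ mxE taft_ext_rep00 /= mulrC.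
Qed.

Lemma ext_rep_left01 t : L t 0 1 = 0.
Proof.
move: t; apply: (@tens_ext k T T k^o) => [c u v|c u v|a b].
- by rewrite linearP !mxE.
- by rewrite scaler0 addr0.
by rewrite tscalerE mxE taft_ext_rep01 mulr0.
Qed.

Lemma ext_rep_left11 t : L t 1 1 = tscalel chi chi t.
Proof.
move: t; apply: (@tens_ext k T T k^o) => [c u v|c u v|a b].
- by rewrite linearP !mxE.
- by rewrite !linearP.
by rewrite tscalelE tscalerE mxE taft_ext_rep11 mulrC.
Qed.

(** On [g] both sides are [w^-1] times the square of [E g]. On [x] the actions are [w^-1 E x] on the
    right factor and [E x] on the left one, and conjugation by [E g] absorbs [w^-1]. *)
Lemma ext_rep_braid u :
  R (taft_comul hw u) * E g = E g * L (taft_comul hw u).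
Proof.
pose RD := comp_ahom R (taft_comul hw); pose LD := comp_ahom L (taft_comul hw).
have RDE v : RD v = R (taft_comul hw v) by rewrite comp_lfunE.
have LDE v : LD v = L (taft_comul hw v) by rewrite comp_lfunE.
rewrite -RDE -LDE; apply: taft_intertwine; rewrite RDE LDE.
  by rewrite taft_comul_g tscalelE tscalerE -scalerAl -scalerAr.
rewrite taft_comul_x !ahomD !tscalelE !tscalerE taft_character_x.
rewrite !scale0r addr0 add0r rmorph1 scale1r taft_ext_char_g -scalerAl.
by rewrite taft_ext_rep_g taft_ext_rep_x Exg scalerA mulVf // scale1r.
Qed.
End Extension.

(** * The root of unity is unchanged by a twist *)

Section GaugeEquivalence.
Variables (k : fieldType) (n : nat) (w1 w2 : k).
Variables (hw1 : n.-primitive_root w1) (hw2 : n.-primitive_root w2).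
Local Notation T1 := (taft_alg hw1).
Local Notation T2 := (taft_alg hw2).

Lemma taft_twist_root (F : tensor T1 T1) (f : 'AHom(T2, T1)) :
    (1 < n)%N -> F \is a GRing.unit ->
    tcounitl (taft_counit hw1) F = 1 -> tcounitr (taft_counit hw1) F = 1 ->
    (forall u, exists v, f v = u) ->
    (forall h, F * taft_comul hw1 (f h) / F = tmap f f (taft_comul hw2 h)) ->
    (forall h, taft_counit hw1 (f h) = taft_counit hw2 h) ->
  w1 = w2.
Proof.
move=> n_gt1 Fu Fl Fr f_surj f_comul f_counit.
pose E := taft_ext_rep hw1 n_gt1; pose chi := taft_ext_char hw1 n_gt1.
pose E' := comp_ahom E f; pose chi' := comp_ahom chi f.
have E'E u : E' u = E (f u) by rewrite comp_lfunE.
have chi'E u : chi' u = chi (f u) by rewrite comp_lfunE.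
pose R := tscalel chi E; pose L := tscaler E chi.
pose X := E (f (taft_x hw2)); pose G := E (f (taft_g hw2)).
pose c : k := chi (f (taft_g hw2)).
have X00 : X 0 0 = 0 by rewrite taft_ext_rep00 f_counit taft_counit_x.
have X01 : X 0 1 = 0 by rewrite taft_ext_rep01.
have X11 : X 1 1 = 0 by rewrite taft_ext_rep11 -chi'E taft_character_x.
have X10 : X 1 0 != 0.
  (* Otherwise the image of E would be commutative. *)
  apply/eqP => X10; have X0 : X = 0 by apply: eq_mx2; rewrite mxE.
  have [g' g'E] := f_surj (taft_g hw1); have [x' x'E] := f_surj (taft_x hw1).
  have := @taft_image_commutative _ _ _ hw2 _ E' _ g' x'.
  rewrite !E'E g'E x'E => /(_ X0) /matrixP /(_ 1 0) /eqP.
  rewrite taft_ext_rep_g taft_ext_rep_x !mulmx2E !mxE /= !mul0r !addr0 !mulr1.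
  rewrite add0r mul1r expr1 invr_eq1 -[w1]expr1 -(prim_order_dvd hw1) dvdn1.
  by rewrite gtn_eqF.
have cw2 : c * w2 = 1.
  have : X * G = w2 *: (G * X).
    by rewrite /X /G -!ahomM taft_xg !ahomZ.
  move/matrixP/(_ 1 0); rewrite [RHS]mxE !mulmx2E X00 X11 mulr0 mul0r add0r addr0.
  rewrite taft_ext_rep00 f_counit taft_counit_g mulr1 taft_ext_rep11 -/c.
  by move=> e; apply: (mulIf X10); rewrite mul1r {2}e; ring.
have cw1 : c * w1 = 1.
  pose Y := L F^-1.
  have LY : L F * Y = 1 by rewrite -ahomM divrr // rmorph1.
  have YL : Y * L F = 1 by rewrite -ahomM mulVr // rmorph1.
  have [D DE] : exists2 D, D = taft_comul hw1 (f (taft_x hw2)) &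
      F * D = tmap f f (taft_comul hw2 (taft_x hw2)) * F.
    by eexists; first reflexivity; rewrite -f_comul divrK.
  have tE : tmap f f (taft_comul hw2 (taft_x hw2)) =
      f (taft_x hw2) *t 1 + f (taft_g hw2) *t f (taft_x hw2).
    by rewrite taft_comul_x linearD /= !tmapE rmorph1.
  rewrite tE => FD.
  (* As [chi] kills [f x], one summand of the coproduct survives: with factor [c] under [R], with
     factor 1 under [L]. *)
  have RX : c *: X * R F = R F * R D.
    rewrite -ahomM FD ahomM ahomD !tscalelE -chi'E taft_character_x.
    by rewrite scale0r add0r.
  have LX : X * L F = L F * L D.
    rewrite -ahomM FD ahomM ahomD !tscalerE -chi'E taft_character_x.
    by rewrite scale0r addr0 rmorph1 scale1r.
  have braid : R D * E (taft_g hw1) = E (taft_g hw1) * L D.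
    by rewrite DE ext_rep_braid.
  have LDY : L D * Y = Y * X.
    by rewrite -[L D]mul1r -YL -[Y * _ * _]mulrA -LX -!mulrA LY mulr1.
  (* The intertwiner of the twist, lower triangular with diagonal [(1, w1^-1)]: [R F] and [Y] have
     inverse lower right entries, both being values of [chi (x) chi]. The entry (1, 0) then reads
     [c = w1^-1], up to the nonzero factor [X 1 0]. *)
  have : c *: X * (R F * E (taft_g hw1) * Y) = R F * E (taft_g hw1) * Y * X.
    by rewrite !mulrA RX -[R F * R D * _]mulrA braid -!mulrA LDY.
  move/matrixP/(_ 1 0).
  have F11 : R F 1 1 * Y 1 1 = 1.
    rewrite ext_rep_right11 ext_rep_left11.
    by have := ahomM (tscalel chi chi) F F^-1; rewrite divrr // rmorph1 => <-.
  have Y00 : Y 0 0 = 1.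
    rewrite ext_rep_left00 (_ : tcounitl _ _ = 1) ?rmorph1 //.
    by rewrite rmorphV //= Fl invr1.
  have F00 : R F 0 0 = 1 by rewrite ext_rep_right00 Fr rmorph1.
  have w10 : w1 != 0 by rewrite (prim_root_eq0 hw1) gtn_eqF // ltnW.
  have R01 : R F 0 1 = 0 by exact: ext_rep_right01.
  have Y01 : Y 0 1 = 0 by exact: ext_rep_left01.
  have G00 : E (taft_g hw1) 0 0 = 1 by rewrite taft_ext_rep_g mxE mulr1.
  have G01 : E (taft_g hw1) 0 1 = 0 by rewrite taft_ext_rep_g mxE mul0r.
  have G10 : E (taft_g hw1) 1 0 = 0 by rewrite taft_ext_rep_g mxE mul0r.
  have G11 : E (taft_g hw1) 1 1 = w1^-1 by rewrite taft_ext_rep_g mxE mul1r.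
  rewrite !mulmx2E [(c *: X) 1 0]mxE [(c *: X) 1 1]mxE.
  rewrite X00 X11 F00 R01 Y00 Y01 G00 G01 G10 G11.
  rewrite !(mulr0, mul0r, addr0, add0r, mulr1) => E10.
  by apply: (mulIf X10); rewrite mulrAC E10 -F11; field.
have c0 : c != 0.
  by apply/eqP => c0; move/eqP: cw1; rewrite c0 mul0r eq_sym oner_eq0.
by apply: (mulfI c0); rewrite cw1.
Qed.
End GaugeEquivalence.

(** * The trivial twist and the conclusion *)

Section TrivialTwist.
Variables (k : fieldType) (H : hopf_algebra k).

Fact two_cocycle1 : two_cocycle (1 : tensor H H).
Proof.
split; first by split; rewrite ?unitr1 // rmorph1.
rewrite -tens1 !tmapE !id_lfunE !rmorph1 !tens1 mulr1 mul1r.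
by rewrite -[1 in RHS]tens1 -[X in X *t _]tens1 tassocE.
Qed.

Lemma gauge_equivalent_refl : gauge_equivalent H H.
Proof.
exists 1, two_cocycle1, (id_ahom H); split=> [|h|h]; last 1 first.
- by rewrite id_lfunE.
- by exists id => h; rewrite id_lfunE.
rewrite id_lfunE [LHS]twist_comulE mul1r invr1 mulr1.
by move: (comul H h); apply: tens_ext => [||a b]; rewrite ?tmapE ?id_lfunE //;
  move=> c u v; rewrite ?linearP.
Qed.
End TrivialTwist.

Lemma taft_gauge_root (k : fieldType) (n : nat) (w1 w2 : k)
    (hw1 : n.-primitive_root w1) (hw2 : n.-primitive_root w2) :
  gauge_equivalent (taft hw1) (taft hw2) -> w1 = w2.
Proof.
have [n_gt1|n_le1] := ltnP 1 n; last first.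
  have n1 : n = 1 by have := prim_order_gt0 hw1; lia.
  have one (w : k) : n.-primitive_root w -> w = 1.
    by move=> /prim_expr_order; rewrite n1 expr1.
  by move=> _; rewrite (one _ hw1) (one _ hw2).
case=> F [hF [f [[f' _ f'K] f_comul f_counit]]].
have [[Fu Fl Fr] _] := hF.
apply: (@taft_twist_root k n w1 w2 hw1 hw2 F f n_gt1 Fu Fl Fr) => [u|h|h].
- by exists (f' u).
- by rewrite -f_comul [RHS]twist_comulE.
- exact: f_counit.
Qed.

Lemma taft_antipode_trace_root (k : fieldType) (char0 : [pchar k] =i pred0)
    (n : nat) (w1 w2 : k)
    (hw1 : n.-primitive_root w1) (hw2 : n.-primitive_root w2) :
  lfun_trace (antipode (taft hw1)) = lfun_trace (antipode (taft hw2)) ->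
  w1 = w2.
Proof.
have nz m : (m.+1)%:R != 0 :> k by move/pcharf0P: char0 => ->.
(* Used with [m.+1] equal to 2 and 4: the product being nonzero, the trace [t] can be cancelled. *)
have cancel (t a b : k) m : a * t = m.+1%:R -> b * t = m.+1%:R -> a = b.
  move=> at_m bt_m; apply: (mulIf (x := t)); last by rewrite at_m.
  by apply/eqP => t0; have := nz m; rewrite -at_m t0 mulr0 eqxx.
move=> tr_eq; case n_odd: (odd n).
  have t1 := taft_antipode_trace_odd hw1 n_odd.
  have t2 := taft_antipode_trace_odd hw2 n_odd.
  rewrite -tr_eq in t2; have /addrI p_eq := cancel _ _ _ _ t1 t2.
  by rewrite -(prim_root_half_sq hw1 n_odd) p_eq prim_root_half_sq.
have t1 := taft_antipode_trace_even hw1 (negbT n_odd).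
have t2 := taft_antipode_trace_even hw2 (negbT n_odd).
by rewrite -tr_eq in t2; have /addrI/oppr_inj := cancel _ _ _ _ t1 t2.
Qed.

Theorem corollary3p3 (k : closedFieldType) (char0 : [pchar k] =i pred0)
    (n : nat) (n_gt0 : (0 < n)%N) (w1 w2 : k)
    (hw1 : n.-primitive_root w1) (hw2 : n.-primitive_root w2) :
  (lfun_trace (antipode (taft hw1)) = lfun_trace (antipode (taft hw2)) <->
   w1 = w2) /\
  (gauge_equivalent (taft hw1) (taft hw2) <-> w1 = w2).
Proof.
split; split=> [|w_eq].
- exact: taft_antipode_trace_root.
(* [taft] depends on the proof of primitivity, so the two proofs must be identified as well. *)
- by subst w2; rewrite (bool_irrelevance hw2 hw1).
- exact: taft_gauge_root.
- by subst w2; rewrite (bool_irrelevance hw2 hw1); exact: gauge_equivalent_refl.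
Qed.
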